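(* Let $\mathcal{A}=\{H_1,\ldots,H_n\}$ be an essential arrangement of $n$ real projective planes in $\mathbb{P}^3(\mathbb{R})$. Then $\mathcal{A}$ is simplicial if and only if $$n+\sum_{p\geq 3}(2-p)\,t_p+\sum_{q\geq 3}(q-2)\sum_{p\geq 3}t_{pq}=0.$$
   Context: An arrangement $\mathcal{A}$ in $\mathbb{P}^3(\mathbb{R})=\mathbb{P}(V)$, $V$ a 4-dimensional real vector space, is a finite set of distinct projective planes $H=\mathbb{P}(\ker a_H)$, $a_H\in V^*\setminus\{0\}$. It is essential if the covectors $a_H$ span $V^*$. A chamber is a connected component of the complement of $\bigcup_{H\in\mathcal{A}}H$. An essential arrangement is simplicial if the closure of every chamber is combinatorially a tetrahedron; equivalently, every chamber has exactly four facets. Let $L_2(\mathcal{A})$ be the set of intersection lines (projective lines that are intersections of planes of $\mathcal{A}$) and $L_3(\mathcal{A})$ the set of vertices (points that are intersections of planes of $\mathcal{A}$). For $L\in L_2(\mathcal{A})$ let $m(L)$ be the number of planes of $\mathcal{A}$ containing $L$, and for $x\in L_3(\mathcal{A})$ let $\nu(x)$ be the number of planes of $\mathcal{A}$ containing $x$. For $p\geq3$, $q\geq2$ put $$t_p=|\{x\in L_3(\mathcal{A}) : \nu(x)=p\}|,\qquad t_{pq}=|\{(x,L)\in L_3(\mathcal{A})\times L_2(\mathcal{A}) : x\in L,\ \nu(x)=p,\ m(L)=q\}|.$$ *)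

(* Defs.v *)
From HB Require Import structures.
From mathcomp Require Import all_boot all_order all_algebra finmap.
From mathcomp Require Import all_classical all_reals all_analysis.
Import GRing.Theory.
Import numFieldNormedType.Exports.
Set Implicit Arguments.
Unset Strict Implicit.
Unset Printing Implicit Defensive.
Local Open Scope classical_set_scope.
Local Open Scope ring_scope.

(* A point of P(V), for V = 'rV[R]_4, is a one-dimensional subspace of V.
   P(V) is the quotient of V minus the origin (with the subspace topology) by
   the map sending v to the line spanned by v, and has the quotient topology. *)
Section ProjectiveSpace.
Variable R : realType.
Notation V := 'rV[R]_4.

Definition punctured : Type := set_type [set v : V | v != 0].
HB.instance Definition _ := Topological.on punctured.

Definition onedim : Type := {W : {vspace V} | \dim W == 1%N}.
HB.instance Definition _ := Choice.on onedim.

Lemma onedim_pi_subproof (v : punctured) : \dim <[val v : V]>%VS == 1%N.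
Proof. by case: v => v /= /set_mem /= v0; rewrite dim_vline v0. Qed.

Lemma onedim_repr_subproof (W : onedim) :
  (vpick (val W) : V) \in [set v : V | v != 0].
Proof.
by apply/mem_set; case: W => W /= /eqP dW; rewrite vpick0 -dimv_eq0 dW.
Qed.

Definition onedim_pi (v : punctured) : onedim :=
  exist _ <[val v : V]>%VS (onedim_pi_subproof v).
Definition onedim_repr (W : onedim) : punctured :=
  exist _ (vpick (val W)) (onedim_repr_subproof W).

Lemma onedim_reprK : cancel onedim_repr onedim_pi.
Proof.
case=> W dW; apply/val_inj => /=; apply/eqP.
rewrite eqEdim -memvE memv_pick /= (eqP dW) dim_vline.
by rewrite vpick0 -dimv_eq0 (eqP dW).
Qed.

HB.instance Definition _ := isQuotient.Build punctured onedim onedim_reprK.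

Definition P3 : Type := quotient_topology onedim.
HB.instance Definition _ := Topological.on P3.
HB.instance Definition _ := Choice.on P3.

Definition subspace_of (x : P3) : {vspace V} := val (x : onedim).

Definition projectivization (W : {vspace V}) : set P3 :=
  [set x | (subspace_of x <= W)%VS].

Definition covector := 'Hom(V, R^o).

Definition plane (f : covector) : set P3 := projectivization (lker f).

Definition is_projective_line (L : set P3) : Prop :=
  exists W : {vspace V}, \dim W = 2%N /\ L = projectivization W.

End ProjectiveSpace.

Record arrangement (R : realType) (n : nat) := Arrangement {
  form :> 'I_n -> covector R;
  form_neq0 : forall i, form i != 0;
  form_distinct : injective (fun i => plane (form i)) }.

Section Arrangement.
Variables (R : realType) (n : nat) (A : arrangement R n).

Definition essential : Prop := <<[seq A i | i : 'I_n]>>%VS = fullv.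

Definition complement : set (P3 R) := ~` \bigcup_i plane (A i).

Definition chamber (C : set (P3 R)) : Prop :=
  exists2 x, complement x & C = connected_component complement x.

(* The intersection over all of 'I_n yields the empty face when A is essential,
   and the one over the empty family yields the closed chamber itself. *)
Definition faces (C : set (P3 R)) : set (set (P3 R)) :=
  [set closure C `&` \bigcap_(i in S) plane (A i) | S in [set: set 'I_n]].

(* The face poset is isomorphic to that of a tetrahedron, which is the poset of
   all subsets of its four vertices. *)
Definition combinatorial_tetrahedron (C : set (P3 R)) : Prop :=
  exists phi : {set 'I_4} -> set (P3 R),
    range phi = faces C /\
    forall I J : {set 'I_4}, phi I `<=` phi J <-> I \subset J.

Definition simplicial : Prop :=
  forall C, chamber C -> combinatorial_tetrahedron C.

Definition L2 : set (set (P3 R)) :=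
  [set L | is_projective_line L /\
           exists S : set 'I_n, L = \bigcap_(i in S) plane (A i)].

Definition L3 : set (P3 R) :=
  [set x | exists S : set 'I_n, [set x] = \bigcap_(i in S) plane (A i)].

Definition line_mult (L : set (P3 R)) : nat := #|[set i | `[< L `<=` plane (A i) >]]%SET|.

Definition nu (x : P3 R) : nat := #|[set i | `[< plane (A i) x >]]%SET|.

(* L2 and L3 are finite, so fset_set does not take its default value here. *)
Definition t_p (p : nat) : nat :=
  #|` fset_set [set x : P3 R | L3 x /\ nu x = p]|%fset.

Definition t_pq (p q : nat) : nat :=
  #|` fset_set [set xL : P3 R * set (P3 R) |
      [/\ L3 xL.1, L2 xL.2, xL.2 xL.1, nu xL.1 = p & line_mult xL.2 = q]]|%fset.

End Arrangement.

(* Main.v *)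
(* Let f_2 and f_3 be the numbers of facets and of chambers. Each facet lies on
   two chambers and each chamber has at least four facets, since its walls span
   V^*. So 2 f_3 - f_2 <= 0, with equality iff every chamber has exactly four
   walls, i.e. is simplicial. It remains to see that the left-hand side of the
   formula is 2 f_3 - f_2. Whitney's formula writes the number of regions of a
   central arrangement as the sum of (-1)^(|S| + rank S) over all subfamilies S.
   Applied in V, it gives 2 f_3; applied in each hyperplane, and summed, it
   gives 2 f_2. Hence 2 (2 f_3 - f_2) is the sum of
   (2 - |S|) (-1)^(|S| + rank S), and grouping the S according to the flat they
   span leaves only contributions of planes, lines and vertices, because
   (2 - |S|) (-1)^|S| sums to 0 over the subsets of any set with at least two
   elements. *)
Require Import Defs.
From mathcomp Require Import all_boot all_order all_algebra finmap.
From mathcomp Require Import all_classical all_reals all_analysis.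
From mathcomp Require Import ring lra zify.
Import Order.TTheory GRing.Theory Num.Theory.
Import numFieldNormedType.Exports.
Set Implicit Arguments.
Unset Strict Implicit.
Unset Printing Implicit Defensive.
Local Open Scope classical_set_scope.
Local Open Scope ring_scope.

(** * Regions of a central arrangement *)

(** Finitely many strict inequalities survive a small displacement. *)
Lemma perturb_gt0 (R : realFieldType) (I : finType) (J : {set I}) (x y : I -> R) :
  (forall j, j \in J -> 0 < x j) ->
  exists2 e, 0 < e & forall j, j \in J -> 0 < x j + e * y j.
Proof.
(* The denominators 1 + |y_j| are never zero and make e |y_j| strictly smaller than x_j; the default
   value 1 covers an empty [J]. *)
move=> x0; pose e := \big[Num.min/1]_(j in J) (x j / (1 + `|y j|)).
have d0 (j : I) : 0 < 1 + `|y j| by rewrite ltr_pwDl.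
exists e.
  by apply: lt_bigmin => // j jJ; rewrite divr_gt0 ?x0.
move=> j jJ; have : e <= x j / (1 + `|y j|) by apply: bigmin_le_cond.
rewrite ler_pdivlMr // => ex; have e0 : 0 < e.
  by apply: lt_bigmin => // k kJ; rewrite divr_gt0 ?x0.
have : `|e * y j| < x j.
  by rewrite normrM gtr0_norm //; apply: lt_le_trans ex; rewrite mulrDr mulr1 ltrDr.
by rewrite ltr_norml => /andP[h _]; rewrite addrC -subr_gt0 opprK in h *; lra.
Qed.

Section Forms.
Import fintype boot.finset.
Variables (R : realType) (V : vectType R) (I : finType) (a : I -> 'Hom(V, R^o)).

Lemma homD (f : 'Hom(V, R^o)) u v : (f (u + v) : R) = (f u : R) + (f v : R).
Proof. exact: (linearD (f : {linear V -> R^o})). Qed.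

Lemma homZ (f : 'Hom(V, R^o)) c v : (f (c *: v) : R) = c * (f v : R).
Proof. exact: (linearZ_LR (f : {linear V -> R^o})). Qed.

Lemma homN (f : 'Hom(V, R^o)) v : (f (- v) : R) = - (f v : R).
Proof. exact: (linearN (f : {linear V -> R^o})). Qed.

(** Orienting each form by [P] turns the sign conditions of a region into plain positivity, so that
    cone arguments need no case distinction. *)
Definition sgn_form (P : {set I}) (i : I) (v : V) : R :=
  (if i \in P then a i v else - a i v).

Lemma sgn_formE P i v : sgn_form P i v = if i \in P then a i v : R else - (a i v : R).
Proof. by []. Qed.

Lemma sgn_formD P i u v : sgn_form P i (u + v) = sgn_form P i u + sgn_form P i v.
Proof. by rewrite /sgn_form; case: ifP; rewrite homD ?opprD. Qed.

Lemma sgn_formZ P i c v : sgn_form P i (c *: v) = c * sgn_form P i v.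
Proof. by rewrite /sgn_form; case: ifP; rewrite homZ ?mulrN. Qed.

Lemma sgn_formN P i v : sgn_form P i (- v) = - sgn_form P i v.
Proof. by rewrite -scaleN1r sgn_formZ mulN1r. Qed.

Lemma sgn_form0 P i : sgn_form P i 0 = 0.
Proof. by rewrite -(scale0r 0) sgn_formZ mul0r. Qed.

Lemma sgn_form_eq0 P i v : (sgn_form P i v == 0) = (v \in lker (a i)).
Proof. by rewrite memv_ker /sgn_form; case: ifP; rewrite ?oppr_eq0. Qed.

Definition in_cone (J P : {set I}) (v : V) : Prop :=
  forall i, i \in J -> 0 < sgn_form P i v.

Lemma in_cone_perturb J P u v : in_cone J P u ->
  exists2 e, 0 < e & in_cone J P (u + e *: v).
Proof.
move=> /(perturb_gt0 (sgn_form P ^~ v))[e e0 he]; exists e => // i iJ.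
by rewrite sgn_formD sgn_formZ he.
Qed.

(* A region is coded by the set of the forms that are positive on it. *)
Definition regions (W : {vspace V}) (J : {set I}) : {set {set I}} :=
  [set P : {set I} | (P \subset J) && `[< exists2 v, v \in W & in_cone J P v >]].

(** Splits the regions of [i |: J] by the side of the hyperplane [i]; a region of [J] cut by it
    occurs for both values of [s]. *)
Definition ext_regions (W : {vspace V}) (J : {set I}) (i : I) (s : bool) : {set {set I}} :=
  [set P : {set I} | (P \subset J) &&
     `[< exists2 v, v \in W & in_cone J P v /\ 0 < sgn_form (if s then [set i] else set0) i v >]].

Lemma in_cone_setU1 (J P : {set I}) i v : i \notin J -> P \subset i |: J ->
  in_cone (i |: J) P v <->
  in_cone J (P :\ i) v /\ 0 < sgn_form (if i \in P then [set i] else set0) i v.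
Proof.
move=> iJ PJ; split.
  move=> h; split; last first.
    by have := h i (setU11 _ _); rewrite /sgn_form; case: (i \in P); rewrite !inE ?eqxx.
  move=> j jJ; have := h j; rewrite !inE jJ orbT => /(_ isT).
  have ji : j != i by apply: contraNneq iJ => <-.
  by rewrite /sgn_form !inE ji.
move=> [h1 h2] j; rewrite !inE => /orP[/eqP-> |jJ].
  by move: h2; rewrite /sgn_form; case: (i \in P); rewrite !inE ?eqxx.
have ji : j != i by apply: contraNneq iJ => <-.
by have := h1 j jJ; rewrite /sgn_form !inE ji.
Qed.

Lemma regions_setU1 W (J : {set I}) i : i \notin J ->
  regions W (i |: J) = [set i |: Q | Q in ext_regions W J i true] :|: ext_regions W J i false.
Proof.
move=> iJ; apply/setP => P; rewrite !inE; apply/andP/orP.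
  move=> [PJ /asboolP[v vW /(in_cone_setU1 _ iJ PJ) h]].
  have PJ' : P :\ i \subset J by rewrite subDset.
  have [iP|iP] := boolP (i \in P).
    left; apply/imsetP; exists (P :\ i); last by rewrite setD1K.
    by rewrite inE PJ'; apply/asboolP; exists v => //; rewrite iP in h.
  right; rewrite (negbTE iP) in h.
  have PiP : P :\ i = P by apply/setDidPl; rewrite disjoint_sym disjoints1.
  by rewrite PiP in h PJ'; rewrite PJ'; apply/asboolP; exists v.
case.
  move=> /imsetP[Q]; rewrite inE => /andP[QJ /asboolP[v vW h]] ->.
  have iQ : i \notin Q by apply: contra iJ; apply: (subsetP QJ).
  split; first exact: setUS.
  apply/asboolP; exists v => //; apply/in_cone_setU1 => //; first exact: setUS.
  by rewrite setU11 setU1K.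
move=> /andP[PJ /asboolP[v vW h]].
have iQ : i \notin P by apply: contra iJ; apply: (subsetP PJ).
have PJ' : P \subset i |: J by apply: subset_trans PJ (subsetU1 _ _).
split => //; apply/asboolP; exists v => //; apply/in_cone_setU1 => //.
rewrite (negbTE iQ).
by have -> : P :\ i = P by apply/setDidPl; rewrite disjoint_sym disjoints1.
Qed.

Lemma card_regions_setU1 W (J : {set I}) i : i \notin J ->
  #|regions W (i |: J)| = (#|ext_regions W J i true| + #|ext_regions W J i false|)%N.
Proof.
move=> iJ; rewrite regions_setU1 // cardsU.
have sub s Q : Q \in ext_regions W J i s -> i \notin Q.
  by rewrite inE => /andP[QJ _]; apply: contra iJ; apply: (subsetP QJ).
rewrite [X in (_ - X)%N](_ : _ = 0)%N ?subn0.
  rewrite card_in_imset // => Q1 Q2 h1 h2 e.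
  by rewrite -(setU1K (sub _ _ h1)) e setU1K // (sub _ _ h2).
apply: eq_card0 => P; apply/negbTE; apply/negP => /setIP[/imsetP[Q _ ->] /sub].
by rewrite setU11.
Qed.

(** A region is open in [W], and [W] is not inside the hyperplane [i], so a point of the region on
    that hyperplane can be pushed off it within [W]. *)
Lemma ext_regionsU W (J : {set I}) i : ~~ (W <= lker (a i))%VS ->
  ext_regions W J i true :|: ext_regions W J i false = regions W J.
Proof.
move=> /subvPn[d dW]; rewrite memv_ker => di; apply/setP => P; rewrite !inE -andb_orr.
case: (boolP (P \subset J)) => //= PJ; apply/orP/asboolP.
  by case=> /asboolP[v vW [h _]]; exists v.
move=> [v vW vP].
have [e e0 he] := in_cone_perturb d vP.
pose w := if a i v == 0 then v + e *: d else v.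
have wW : w \in W by rewrite /w; case: ifP => // _; rewrite memvD ?memvZ.
have wP : in_cone J P w by rewrite /w; case: ifP.
have wi : (a i w : R) != 0.
  rewrite /w; case: ifP => [/eqP h|->//]; rewrite homD h add0r homZ.
  by rewrite mulf_neq0 // lt0r_neq0.
case: (ltgtP (a i w : R) 0) wi => // h _; [right|left]; apply/asboolP; exists w => //; split => //.
  by rewrite /sgn_form inE oppr_gt0.
by rewrite /sgn_form inE eqxx.
Qed.

Lemma in_cone_convex J P u v (s t : R) : in_cone J P u -> in_cone J P v ->
  0 < s -> 0 < t -> in_cone J P (s *: u + t *: v).
Proof.
move=> hu hv s0 t0 j jJ; rewrite sgn_formD !sgn_formZ.
by rewrite addr_gt0 // mulr_gt0 ?hu ?hv.
Qed.

(** By convexity, a region with points on both sides of the hyperplane has a point on it.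
    Conversely, a point on it can be pushed to either side. *)
Lemma ext_regionsI W (J : {set I}) i : ~~ (W <= lker (a i))%VS ->
  ext_regions W J i true :&: ext_regions W J i false = regions (W :&: lker (a i)) J.
Proof.
move=> /subvPn[d dW]; rewrite memv_ker => di; apply/setP => P; rewrite !inE.
case: (boolP (P \subset J)) => //= PJ; apply/andP/asboolP.
  move=> [/asboolP[u uW [uP ui]] /asboolP[v vW [vP vi]]].
  rewrite /sgn_form !inE eqxx in ui vi.
  (* Here [a i u] is positive and [a i v] negative, so both weights are positive, and [a i] vanishes
     on the combination. *)
  exists ((- a i v : R) *: u + (a i u : R) *: v); last exact: in_cone_convex.
  rewrite memv_cap memvD ?memvZ //= memv_ker homD !homZ.
  by rewrite mulNr mulrC addNr.
move=> [v]; rewrite memv_cap memv_ker => /andP[vW /eqP vi] vP.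
wlog di0 : d dW di / 0 < (a i d : R).
  move=> H; case: (ltgtP (a i d : R) 0) => d0; last by rewrite d0 eqxx in di.
    by apply: (H (- d)); rewrite ?memvN // homN ?oppr_eq0 // oppr_gt0.
  exact: (H d).
split; apply/asboolP.
  have [e e0 he] := in_cone_perturb d vP.
  exists (v + e *: d); first by rewrite memvD ?memvZ.
  split => //; rewrite /sgn_form inE eqxx homD vi add0r homZ.
  exact: mulr_gt0.
have [e e0 he] := in_cone_perturb (- d) vP.
exists (v + e *: - d); first by rewrite memvD ?memvZ ?memvN.
split => //; rewrite /sgn_form inE homD vi add0r homZ homN.
by rewrite mulrN opprK; exact: mulr_gt0.
Qed.

(** The hyperplane [i] splits in two exactly the regions that it cuts, and these correspond to the
    regions of the restriction to it. *)
Lemma regions_deletion_restriction W (J : {set I}) i : i \notin J -> ~~ (W <= lker (a i))%VS ->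
  #|regions W (i |: J)| = (#|regions W J| + #|regions (W :&: lker (a i)) J|)%N.
Proof.
move=> iJ Wi; rewrite card_regions_setU1 // -(ext_regionsU _ Wi) -(ext_regionsI _ Wi).
by rewrite cardsUI.
Qed.

Definition flat (S : {set I}) : {vspace V} := (\bigcap_(i in S) lker (a i))%VS.

Lemma flatU1 i S : (flat (i |: S) = lker (a i) :&: flat S)%VS.
Proof.
have [iS|iS] := boolP (i \in S); last by rewrite /flat big_setU1.
rewrite (setUidPr _) ?sub1set //; apply/esym/capv_idPr.
by rewrite /flat (big_setD1 i) //= capvSl.
Qed.

Lemma dim_capv_lker W i : ~~ (W <= lker (a i))%VS -> \dim W = (\dim (W :&: lker (a i))).+1.
Proof.
move=> Wi; rewrite -(limg_ker_dim (a i) W) -addn1; congr (_ + _)%N.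
apply/eqP; rewrite eqn_leq; apply/andP; split.
  by apply: leq_trans (dimvS (subvf _)) _; rewrite dimvf.
by rewrite lt0n dimv_eq0 -lkerE.
Qed.

Lemma sum_subsets_setU1 (i : I) (J : {set I}) (F : {set I} -> int) : i \notin J ->
  \sum_(S : {set I} | S \subset i |: J) F S =
  \sum_(S : {set I} | S \subset J) F S + \sum_(S : {set I} | S \subset J) F (i |: S).
Proof.
move=> iJ; rewrite (bigID (fun S : {set I} => i \notin S)) /=; congr (_ + _).
  apply: eq_bigl => S; apply/andP/idP.
    by move=> [SJ iS]; rewrite -(setU1K iJ) subsetD1 SJ.
  move=> SJ; split; first exact: subset_trans SJ (subsetU1 _ _).
  by apply: contra iJ; apply: (subsetP SJ).
rewrite (reindex_onto (fun S => i |: S) (fun S => S :\ i)) /=; last first.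
  by move=> S /andP[_]; rewrite negbK => iS; rewrite setD1K.
apply: eq_bigl => S; apply/andP/idP.
  by move=> [/andP[SJ _] /eqP SE]; rewrite -SE subDset.
move=> SJ; have iS : i \notin S by apply: contra iJ; apply: (subsetP SJ).
by rewrite setU11 setU1K // setUS.
Qed.

(* Whitney's formula: both sides satisfy the same deletion-restriction recursion. *)
Lemma card_regions W J :
  #|regions W J|%:Z =
  \sum_(S : {set I} | S \subset J) (-1) ^+ (#|S| + \dim W + \dim (W :&: flat S)).
Proof.
elim: {J}#|J| {-2}J (erefl #|J|) W => [|k IHk] J cJ W.
  rewrite (cards0_eq cJ).
  rewrite (big_pred1 set0) => [|S]; last by rewrite subset0.
  rewrite cards0 /flat big_set0 capvf add0n -signr_odd addnn odd_double.
  suff -> : regions W set0 = [set set0] by rewrite cards1.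
  apply/setP => P; rewrite !inE subset0; case: eqP => //= _.
  by apply/asboolP; exists 0; [exact: mem0v | move=> i; rewrite inE].
have /card_gt0P[i iJ0] : (0 < #|J|)%N by rewrite cJ.
move: cJ; rewrite (cardsD1 i) iJ0 add1n => -[/IHk IH]; rewrite -(setD1K iJ0).
move: (J :\ i) (setD11 i J) IH => {iJ0}J /negbT iJ IH.
(* If [W] lies in the hyperplane [i], there is no region, and the terms of [S] and [i |: S] cancel:
   their flats meet [W] in the same subspace, but their sizes differ by one. *)
rewrite sum_subsets_setU1 //; have [Wi|Wi] := boolP (W <= lker (a i))%VS.
  rewrite -big_split big1 /=.
    suff -> : regions W (i |: J) = set0 by rewrite cards0.
    apply/setP => P; rewrite !inE; apply/negbTE/negP => /andP[_ /asboolP[v vW]].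
    move=> /(_ i (setU11 _ _)) /lt0r_neq0.
    by rewrite sgn_form_eq0 (subvP Wi).
  move=> S SJ; have iS : i \notin S by apply: contra iJ; apply: (subsetP SJ).
  rewrite cardsU1 iS flatU1 capvA (capv_idPl Wi) !addSn exprS mulN1r.
  exact: subrr.
(* Otherwise restriction loses one element of the subset and one dimension of [W], and the two signs
   cancel. *)
rewrite regions_deletion_restriction // PoszD !IH; congr (_ + _).
apply: eq_bigr => S SJ; have iS : i \notin S by apply: contra iJ; apply: (subsetP SJ).
rewrite cardsU1 iS flatU1 capvA add1n (dim_capv_lker Wi) addnS !addSn.
by rewrite !exprS mulrA mulrNN mulr1 mul1r.
Qed.

(** * Flats and sums of weights by rank *)

Definition flat_closure (S : {set I}) : {set I} := [set i | (flat S <= lker (a i))%VS].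

(** The intersection lattice, coded by closed subfamilies. As [k] is a linear dimension, [flats 1]
    are the vertices and [flats 2] the lines, and the cardinality of a flat is its multiplicity. *)
Definition flats (k : nat) : {set {set I}} :=
  [set F : {set I} | (flat_closure F == F) && (\dim (flat F) == k)].

Lemma subv_flatP (W : {vspace V}) (S : {set I}) :
  reflect (forall i, i \in S -> (W <= lker (a i))%VS) (W <= flat S)%VS.
Proof. exact: subv_bigcapP. Qed.

Lemma flat_sub_lker (S : {set I}) i : i \in S -> (flat S <= lker (a i))%VS.
Proof. by apply/subv_flatP. Qed.

Lemma flatS (S T : {set I}) : S \subset T -> (flat T <= flat S)%VS.
Proof. by move=> /subsetP ST; apply/subv_flatP => i /ST; apply: flat_sub_lker. Qed.

Lemma sub_flat_closure (S : {set I}) : S \subset flat_closure S.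
Proof. by apply/subsetP => i iS; rewrite inE flat_sub_lker. Qed.

Lemma flat_closureE (S : {set I}) : flat (flat_closure S) = flat S.
Proof.
apply/eqP; rewrite eqEsubv flatS ?sub_flat_closure //=.
by apply/subv_flatP => i; rewrite inE.
Qed.

Lemma flat_closureK (S : {set I}) : flat_closure (flat_closure S) = flat_closure S.
Proof. by rewrite /flat_closure flat_closureE. Qed.

Lemma flat_closureS (S T : {set I}) : S \subset T -> flat_closure S \subset flat_closure T.
Proof.
move=> /flatS ST; apply/subsetP => i; rewrite !inE; exact: subv_trans.
Qed.

Hypothesis dimV : \dim {:V} = 4%N.
Hypothesis a_neq0 : forall i, a i != 0.
Hypothesis lker_inj : injective (fun i => lker (a i)).

Lemma dim_lker i : \dim (lker (a i)) = 3%N.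
Proof.
suff /dim_capv_lker : ~~ (fullv <= lker (a i))%VS by rewrite dimV capfv => -[].
rewrite lkerE; apply: contra (a_neq0 i) => /eqP h.
by apply/eqP/lfunP => v; apply/eqP; rewrite lfunE /= -memv0 -h memv_img ?memvf.
Qed.

Lemma flat0 : flat set0 = fullv.
Proof. by rewrite /flat big_set0. Qed.

Lemma flat1 i : flat [set i] = lker (a i).
Proof. by rewrite /flat big_set1. Qed.

(** Distinct hyperplanes meet in codimension two. Hence only the empty set and the singletons have
    rank at most one, which makes two of the rank sums explicit. *)
Lemma dim_flat_le2 (S : {set I}) : (1 < #|S|)%N = (\dim (flat S) <= 2)%N.
Proof.
apply/idP/idP.
  move=> /card_gt1P[i [j [iS jS ij]]].
  have: (flat S <= lker (a i) :&: lker (a j))%VS by rewrite subv_cap !flat_sub_lker.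
  move=> /dimvS /leq_trans; apply.
  suff /dim_capv_lker : ~~ (lker (a i) <= lker (a j))%VS by rewrite dim_lker => -[<-].
  apply: contra ij => ij; apply/eqP/lker_inj/eqP.
  by rewrite eqEdim ij !dim_lker.
apply: contraTT; rewrite -leqNgt -ltnNge.
case: (eqVneq #|S| 0%N) => [/cards0_eq ->|]; first by rewrite flat0 dimV.
rewrite -lt0n => S0 S1; have /eqP/cards1P[i ->] : #|S| = 1%N by lia.
by rewrite flat1 dim_lker.
Qed.

Lemma dim_flat_eq3 (S : {set I}) : (\dim (flat S) == 3%N) = (#|S| == 1%N).
Proof.
apply/idP/idP => [/eqP h|/cards1P[i ->]]; last by rewrite flat1 dim_lker.
have := dim_flat_le2 S; rewrite h /=.
case: (eqVneq #|S| 0%N) => [/cards0_eq S0|]; last lia.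
by move: h; rewrite S0 flat0 dimV.
Qed.

Lemma dim_flat_eq4 (S : {set I}) : (\dim (flat S) == 4%N) = (S == set0).
Proof.
apply/idP/idP => [/eqP h|/eqP ->]; last by rewrite flat0 dimV.
have := dim_flat_le2 S; have := dim_flat_eq3 S; rewrite h /= -cards_eq0; lia.
Qed.

(** The 2 is the coefficient of the number of regions of [V]; the subtracted cardinality arises
    because [S] contributes once to the restriction to each of its members. *)
Definition weight (S : {set I}) : int := (2 - #|S|%:Z) * (-1) ^+ #|S|.

(** Pairing [S] with [i |: S] leaves the sum of (-1)^|S|, and pairing once more with a second
    element [j] cancels it. *)
Lemma sum_weight (T : {set I}) : (1 < #|T|)%N -> \sum_(S : {set I} | S \subset T) weight S = 0.
Proof.
move=> /card_gt1P[i [j [iT jT ij]]]; rewrite -(setD1K iT) sum_subsets_setU1 ?setD11 //.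
have jTi : j \in T :\ i by rewrite !inE eq_sym ij.
have notin (k : I) (U S : {set I}) : S \subset U :\ k -> k \notin S.
  by move=> /subsetP h; apply/negP => /h; rewrite setD11.
rewrite -big_split (eq_bigr (fun S : {set I} => (-1) ^+ #|S|)) /=; last first.
  by move=> S /notin iS; rewrite /weight cardsU1 iS add1n exprS intS; ring.
rewrite -(setD1K jTi) sum_subsets_setU1 ?setD11 // -big_split big1 //= => S /notin jS.
by rewrite cardsU1 jS add1n exprS; ring.
Qed.

(* [k] is the dimension of the flat, that is, 4 minus the rank of [S]. *)
Definition rank_sum (k : nat) (T : {set I}) : int :=
  \sum_(S : {set I} | (S \subset T) && (\dim (flat S) == k)) weight S.

(** Serves with [c] constantly 1, for the cancellation of weights, and with [c k] equal to (-1)^k,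
    for the count of regions. *)
Lemma sum_by_rank (T : {set I}) (c : nat -> int) :
  \sum_(S : {set I} | S \subset T) c (\dim (flat S)) * weight S =
  \sum_(k < 5) c k * rank_sum k T.
Proof.
rewrite (partition_big (fun S => inord (\dim (flat S)) : 'I_5) xpredT) //=.
have lt5 (S : {set I}) : (\dim (flat S) < 5)%N by rewrite ltnS -dimV dimvS ?subvf.
apply: eq_bigr => k _; rewrite /rank_sum mulr_sumr; apply: eq_big => [S|S /andP[_ /eqP<-]].
  by rewrite -val_eqE /= inordK.
by rewrite inordK.
Qed.

Lemma rank_sum_low k (T : {set I}) : (k < \dim (flat T))%N -> rank_sum k T = 0.
Proof.
move=> kT; rewrite /rank_sum big_pred0 // => S; apply/negP => /andP[/flatS/dimvS h /eqP kS].
by move: h; rewrite kS leqNgt kT.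
Qed.

Lemma rank_sum4 T : rank_sum 4 T = 2.
Proof.
rewrite /rank_sum (big_pred1 set0) => [|S]; first by rewrite /weight cards0.
by rewrite dim_flat_eq4 /=; case: eqP => [->|]; rewrite ?sub0set ?andbF.
Qed.

Lemma rank_sum3 T : rank_sum 3 T = - #|T|%:Z.
Proof.
rewrite /rank_sum (eq_bigl (fun S => S \in [set [set i] | i in T])) => [|S].
  rewrite big_imset /= => [|i j _ _ /set1_inj //].
  under eq_bigr do rewrite /weight cards1.
  by rewrite sumr_const -mulr_natl; ring.
rewrite dim_flat_eq3; apply/andP/imsetP => [[ST /cards1P[i Si]]|[i iT ->]].
  by exists i => //; rewrite -sub1set -Si.
by rewrite sub1set iT cards1.
Qed.

(** Subfamilies are grouped by their closure: those with closure [F] are the subsets of [F] of the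
    same rank as [F]. *)
Lemma rank_sum_flats k (T : {set I}) : flat_closure T = T ->
  rank_sum k T = \sum_(F in flats k | F \subset T) rank_sum k F.
Proof.
move=> clT; rewrite {1}/rank_sum.
rewrite (partition_big flat_closure (fun F => (F \in flats k) && (F \subset T))) /=.
  apply: eq_bigr => F; rewrite inE => /andP[/andP[/eqP clF /eqP dF] FT].
  apply: eq_bigl => S; apply/andP/andP.
    by move=> [/andP[ST dS] /eqP <-]; rewrite sub_flat_closure dS.
  move=> [SF dS]; rewrite dS (subset_trans SF FT); split => //.
  rewrite -clF /flat_closure; suff -> : flat S = flat F by [].
  by apply/esym/eqP; rewrite eqEdim flatS // dF (eqP dS) /=.
move=> S /andP[ST dS]; rewrite inE flat_closureK eqxx flat_closureE dS /=.
by rewrite -clT flat_closureS.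
Qed.

(** All weights together cancel, so these three sums are the opposite of the contribution of the
    empty set and the singletons. *)
Lemma rank_sum_total (T : {set I}) : (1 < #|T|)%N ->
  rank_sum 0 T + rank_sum 1 T + rank_sum 2 T = #|T|%:Z - 2.
Proof.
move=> /sum_weight h; have := sum_by_rank T (fun=> 1).
under eq_bigr do rewrite mul1r.
rewrite h !big_ord_recr big_ord0 /= rank_sum4 rank_sum3 => {}h.
by apply/eqP; rewrite -subr_eq0; apply/eqP; rewrite [RHS]h; ring.
Qed.

Lemma flats_card k F : (k <= 2)%N -> F \in flats k -> (1 < #|F|)%N.
Proof. by move=> k2; rewrite inE => /andP[_ /eqP dF]; rewrite dim_flat_le2 dF. Qed.

(** For a single line, the sums in dimensions 0 and 1 are empty, so [rank_sum_total] evaluates the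
    remaining one. *)
Lemma rank_sum2 (T : {set I}) : flat_closure T = T ->
  rank_sum 2 T = \sum_(L in flats 2 | L \subset T) (#|L|%:Z - 2).
Proof.
move=> /rank_sum_flats ->; apply: eq_bigr => L /andP[L2 _].
rewrite -(rank_sum_total (flats_card _ L2)) //.
move: L2; rewrite inE => /andP[_ /eqP dL].
by rewrite (@rank_sum_low 0) ?dL // (@rank_sum_low 1) ?dL // !add0r.
Qed.

(* Equal to 2 f_3 - f_2, where f_2 and f_3 count the facets and the chambers. *)
Definition euler_defect : int :=
  #|I|%:Z + \sum_(F in flats 1) (2 - #|F|%:Z)
  + \sum_(F in flats 1) \sum_(L in flats 2 | L \subset F) (#|L|%:Z - 2).

(** Eliminating [rank_sum 0] through the total over the whole family also cancels [rank_sum 2]. What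
    remains is 2 [#|I|] minus twice [rank_sum 1]. *)
Lemma euler_defectE : (1 < #|I|)%N ->
  \sum_(S : {set I}) (-1) ^+ \dim (flat S) * weight S = 2 * euler_defect.
Proof.
move=> I1; have clT : flat_closure setT = setT.
  by apply/eqP; rewrite eqEsubset subsetT sub_flat_closure.
have := sum_by_rank setT (fun k => (-1) ^+ k).
rewrite (eq_bigl xpredT) => [->|S]; last by rewrite subsetT.
rewrite !big_ord_recr big_ord0 /= rank_sum4 rank_sum3.
have := @rank_sum_total setT; rewrite cardsT => /(_ I1) tot.
(* At each vertex the sum in dimension 0 is empty, so the local total expresses [rank_sum 1] by the
   lines through that vertex. *)
have r1 : rank_sum 1 setT = - \sum_(F in flats 1) (2 - #|F|%:Z)
  - \sum_(F in flats 1) \sum_(L in flats 2 | L \subset F) (#|L|%:Z - 2).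
  rewrite rank_sum_flats // -opprD -big_split -sumrN /=.
  apply: eq_big => [F|F /andP[F1 _]]; first by rewrite subsetT andbT.
  have := rank_sum_total (flats_card (ltn0Sn 1) F1).
  move: F1; rewrite inE => /andP[/eqP clF /eqP dF].
  rewrite (@rank_sum_low 0) ?dF // rank_sum2 // => h.
  by rewrite -[LHS]add0r (canRL (addrK _) h); ring.
rewrite /euler_defect; move: r1 tot.
set A := \sum_(_ in _) _; set B := \sum_(_ in _) _.
move=> r1 tot.
have -> : rank_sum 0 setT = #|I|%:Z - 2 - rank_sum 1 setT - rank_sum 2 setT.
  by rewrite -tot; ring.
by rewrite r1; ring.
Qed.

(** Whitney's formula in [V] and in each hyperplane. A subset [S] avoiding [i], restricted to the
    hyperplane [i], has the sign of [i |: S] in [V]; hence each subset is subtracted as often as it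
    has elements. *)
Lemma sum_regions_weight :
  2 * #|regions fullv setT|%:Z - \sum_i #|regions (lker (a i)) (setT :\ i)|%:Z =
  \sum_(S : {set I}) (-1) ^+ \dim (flat S) * weight S.
Proof.
have -> : \sum_i #|regions (lker (a i)) (setT :\ i)|%:Z =
    \sum_i \sum_(S : {set I} | i \in S) (-1) ^+ (#|S| + \dim (flat S)) :> int.
  apply: eq_bigr => i _; rewrite card_regions dim_lker.
  rewrite [RHS](reindex_onto (fun S => i |: S) (fun S => S :\ i)) /=; last exact: setD1K.
  apply: eq_big => [S|S SJ].
    apply/idP/andP => [/subsetP h|[_ /eqP <-]].
      have iS : i \notin S by apply/negP => /h; rewrite setD11.
      by rewrite setU11 setU1K.
    by rewrite setSD // subsetT.
  have iS : i \notin S by apply/negP => /(subsetP SJ); rewrite setD11.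
  by rewrite cardsU1 iS flatU1 add1n addSn addnAC addn3 !exprS !mulN1r !opprK.
rewrite card_regions (exchange_big_dep xpredT) //=.
rewrite [X in 2 * X](eq_bigl xpredT) => [|S]; last by rewrite subsetT.
rewrite mulr_sumr -sumrB; apply: eq_bigr => S _; rewrite sumr_const capfv dimV.
rewrite /weight addnAC addn4 !exprS !mulN1r !opprK exprD -[X in _ - X]mulr_natl (natz #|S|).
by rewrite -mulrBl [RHS]mulrC mulrA.
Qed.

End Forms.

(** * Walls of a region *)

Section Walls.
Import fintype boot.finset.
Variables (R : realType) (V : vectType R) (I : finType) (a : I -> 'Hom(V, R^o)).
Local Notation flat := (flat a).
Local Notation sgn_form := (sgn_form a).
Local Notation in_cone := (in_cone a).

(** The witness is a point in the relative interior of the facet. Thus facets in the hyperplane [i]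
    are regions of the arrangement restricted to it. *)
Definition walls (P : {set I}) : {set I} :=
  [set i | `[< exists2 v, v \in lker (a i) & in_cone (setT :\ i) P v >]].

Definition closed_cone (P : {set I}) (v : V) : Prop := forall i, 0 <= sgn_form P i v.

Lemma in_cone_eq (J P Q : {set I}) v : P :&: J = Q :&: J -> in_cone J P v -> in_cone J Q v.
Proof.
move=> PQ h i iJ; have := h i iJ; have := in_setI i P J.
by rewrite PQ inE iJ !andbT !sgn_formE => ->.
Qed.

Lemma walls_witness P i : i \in walls P ->
  exists2 v, v \in lker (a i) & in_cone (setT :\ i) P v.
Proof. by rewrite inE => /asboolP. Qed.

Lemma regions_setTP P :
  reflect (exists v, in_cone setT P v) (P \in regions a fullv setT).
Proof.
rewrite inE subsetT; apply: (iffP (asboolP _)) => [[v _ h]|[v h]]; first by exists v.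
by exists v => //; apply: memvf.
Qed.

Hypothesis a_neq0 : forall i, a i != 0.

Lemma exists_sgn_form_gt0 P i : exists d, 0 < sgn_form P i d.
Proof.
have [d di] : exists d, sgn_form P i d != 0.
  apply: contrapT => /forallNP h; have /negP := a_neq0 i; apply.
  apply/eqP/lfunP => v; rewrite lfunE /=.
  by have /negP := h v; rewrite negbK sgn_form_eq0 memv_ker => /eqP.
case: (ltgtP (sgn_form P i d) 0) di => // h _; last by exists d.
by exists (- d); rewrite sgn_formN oppr_gt0.
Qed.

(** The facet point is pushed to the positive side of the [i]-th oriented form. Since [P] may or may
    not contain [i], both sides of the facet carry a region. *)
Lemma region_of_wall (P : {set I}) i v : v \in lker (a i) -> in_cone (setT :\ i) P v ->
  exists u, in_cone setT P u.
Proof.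
move=> vi vP; have [d di] := exists_sgn_form_gt0 P i.
have [e e0 he] := in_cone_perturb d vP; exists (v + e *: d) => j _.
have [->|ji] := eqVneq j i; last by apply: he; rewrite !inE ji.
rewrite sgn_formD sgn_formZ; move: vi; rewrite -(sgn_form_eq0 a P) => /eqP ->.
by rewrite add0r mulr_gt0.
Qed.

(** A facet in the hyperplane [i] borders two regions, whose codes differ exactly in [i]. *)
Lemma card_regions_wall i :
  #|[set P in regions a fullv setT | i \in walls P]| =
  (2 * #|regions a (lker (a i)) (setT :\ i)|)%N.
Proof.
set Q := regions a (lker (a i)) (setT :\ i).
have Qi P : P \in Q -> i \notin P.
  by rewrite inE => /andP[/subsetP h _]; apply/negP => /h; rewrite setD11.
have -> : [set P in regions a fullv setT | i \in walls P] = Q :|: [set i |: P | P in Q].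
  have key P : (P \in [set P in regions a fullv setT | i \in walls P]) = (P :\ i \in Q).
    rewrite inE; apply/andP/idP.
      move=> [_ /walls_witness[v vi vP]]; rewrite inE setSD ?subsetT //.
      apply/asboolP; exists v => //; apply: in_cone_eq vP.
      by apply/setP => j; rewrite !inE; case: (j == i); rewrite ?andbF.
    rewrite inE => /andP[_ /asboolP[v vi vP]].
    have {}vP : in_cone (setT :\ i) P v.
      by apply: in_cone_eq vP; apply/setP => j; rewrite !inE; case: (j == i); rewrite ?andbF.
    split; last by rewrite inE; apply/asboolP; exists v.
    exact/regions_setTP/(region_of_wall vi vP).
  apply/setP => P; rewrite key in_setU; apply/idP/orP.
    move=> h; have [iP|iP] := boolP (i \in P); [right|left].
      by apply/imsetP; exists (P :\ i) => //; rewrite setD1K.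
    suff PiP : P :\ i = P by rewrite -PiP.
    by apply/setDidPl; rewrite disjoint_sym disjoints1.
  case=> [PQ|/imsetP[S SQ ->]]; last by rewrite setU1K // Qi.
  suff -> : P :\ i = P by [].
  by apply/setDidPl; rewrite disjoint_sym disjoints1 Qi.
rewrite cardsU [X in (_ - X)%N](_ : _ = 0)%N ?subn0.
  rewrite card_in_imset ?mul2n ?addnn // => S T /Qi iS /Qi iT e.
  by rewrite -(setU1K iS) e setU1K.
apply: eq_card0 => P; apply/negbTE/negP => /setIP[/Qi h /imsetP[S _ PS]].
by rewrite PS setU11 in h.
Qed.

(** Double count of the pairs of a region and one of its walls. *)
Lemma sum_card_walls :
  (\sum_(P in regions a fullv setT) #|walls P| =
   2 * \sum_i #|regions a (lker (a i)) (setT :\ i)|)%N.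
Proof.
rewrite big_distrr /=; under [RHS]eq_bigr do rewrite -card_regions_wall.
under eq_bigr do rewrite -sum1_card.
rewrite (exchange_big_dep xpredT) //=; apply: eq_bigr => i _.
by rewrite -sum1_card; apply: eq_bigl => P; rewrite [RHS]inE.
Qed.

(** * Irredundant systems of inequalities *)

Definition defining (P T : {set I}) : Prop :=
  forall v, in_cone T P v -> in_cone setT P v.

(** Moving [w] slightly towards the interior point [u] makes the weak inequalities of [T] strict. *)
Lemma defining_closed (P T : {set I}) u w : in_cone setT P u -> defining P T ->
  (forall i, i \in T -> 0 <= sgn_form P i w) -> closed_cone P w.
Proof.
move=> uP TP wT i; rewrite leNgt; apply/negP => wi.
have ui := uP i (in_setT i).
(* With this [c], the [i]-th form at [w + c *: u] is half its value at [w], hence still negative. *)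
pose c := - sgn_form P i w / (2 * sgn_form P i u).
have c0 : 0 < c by rewrite divr_gt0 ?oppr_gt0 ?mulr_gt0.
have /TP /(_ i (in_setT i)) : in_cone T P (w + c *: u).
  move=> j jT; rewrite sgn_formD sgn_formZ ltr_wpDl ?wT // mulr_gt0 // uP //.
rewrite sgn_formD sgn_formZ /c.
have -> : - sgn_form P i w / (2 * sgn_form P i u) * sgn_form P i u = - sgn_form P i w / 2.
  by field; apply: lt0r_neq0.
by move: wi; lra.
Qed.

Hypothesis lker_incomp : forall i j, i != j -> ~~ (lker (a i) <= lker (a j))%VS.

(* For [i] in [T], some [v] satisfies all the inequalities of [T] but the [i]-th.
   The point [z] of the segment from [u] to [v] on the hyperplane [i] lies on no
   other hyperplane [j]: otherwise, moving [z] slightly within the hyperplane [i]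
   would violate the [j]-th inequality but none of those of [T]. *)
Lemma minimal_defining_walls (P T : {set I}) u : in_cone setT P u -> defining P T ->
  (forall i, i \in T -> ~ defining P (T :\ i)) -> T \subset walls P.
Proof.
move=> uP TP Tmin; apply/subsetP => i iT.
have /existsNP[v /not_implyP[vT vP]] := Tmin i iT.
have ui := uP i (in_setT i).
have vi : sgn_form P i v <= 0.
  rewrite leNgt; apply/negP => vi; apply: vP; apply: TP => j jT.
  by have [->//|ji] := eqVneq j i; apply: vT; rewrite !inE ji.
pose z := (- sgn_form P i v) *: u + (sgn_form P i u) *: v.
have zi : sgn_form P i z = 0 by rewrite sgn_formD !sgn_formZ; ring.
have zT : in_cone (T :\ i) P z.
  move=> j jTi; rewrite sgn_formD !sgn_formZ ltr_wpDl ?mulr_ge0 ?oppr_ge0 //.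
    by apply/ltW/uP.
  by rewrite mulr_gt0 ?vT.
have closed (w : V) : sgn_form P i w = 0 -> in_cone (T :\ i) P w -> closed_cone P w.
  move=> wi wT; apply: (defining_closed uP TP) => j jT.
  by have [->|ji] := eqVneq j i; [rewrite wi | apply/ltW/wT; rewrite !inE ji].
rewrite inE; apply/asboolP; exists z; first by rewrite -(sgn_form_eq0 a P) zi.
move=> j; rewrite !inE andbT => ji; rewrite lt_neqAle closed // andbT eq_sym.
apply/negP => /eqP zj.
have /subvPn[d0 d0i d0j] := lker_incomp (negbT (etrans (eq_sym i j) (negbTE ji))).
have [d di dj] : exists2 d, d \in lker (a i) & sgn_form P j d < 0.
  move: d0j; rewrite -(sgn_form_eq0 a P).
  case: (ltgtP (sgn_form P j d0) 0) => // h _; first by exists d0.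
  by exists (- d0); rewrite ?memvN // sgn_formN oppr_lt0.
have [e e0 he] := in_cone_perturb d zT.
have := closed (z + e *: d); rewrite sgn_formD sgn_formZ zi add0r.
move: di; rewrite -(sgn_form_eq0 a P) => /eqP ->; rewrite mulr0 => /(_ erefl he j).
by rewrite sgn_formD sgn_formZ zj add0r pmulr_rge0 // leNgt dj.
Qed.

(** The full family is defining, so there is a minimal defining subfamily, and it consists of
    walls. *)
Lemma closed_cone_walls (P : {set I}) u w : in_cone setT P u ->
  (forall i, i \in walls P -> 0 <= sgn_form P i w) -> closed_cone P w.
Proof.
move=> uP; have [|T /minsetP[/asboolP TP Tmin]] := @ex_minset _ (fun T => `[< defining P T >]).
  by exists setT; apply/asboolP.
move=> wP; apply: (defining_closed uP TP) => i iT; apply: wP.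
suff /subsetP : T \subset walls P by apply.
apply: (minimal_defining_walls uP TP) => j jT /asboolP /Tmin => /(_ (subsetDl _ _)) h.
by move: jT; rewrite -h setD11.
Qed.

(** * Walls of regions of an essential arrangement *)

Hypothesis flatT : flat setT = 0%VS.

(** A vector on all walls lies in the closed cone together with its opposite, so every form vanishes
    on it. *)
Lemma flat_walls (P : {set I}) u : in_cone setT P u -> flat (walls P) = 0%VS.
Proof.
move=> uP; apply/eqP; rewrite -subv0 -flatT; apply/subvP => v vW.
have vW0 i : i \in walls P -> sgn_form P i v = 0.
  move=> iW; apply/eqP; rewrite sgn_form_eq0; apply: subvP vW; exact: flat_sub_lker.
have v0 : closed_cone P v by apply: (closed_cone_walls uP) => i /vW0 ->.
have nv0 : closed_cone P (- v).
  by apply: (closed_cone_walls uP) => i /vW0; rewrite sgn_formN => ->; rewrite oppr0.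
rewrite memvE; apply/subv_flatP => i _; rewrite -memvE -(sgn_form_eq0 a P).
by rewrite eq_le v0 andbT -oppr_ge0 -sgn_formN nv0.
Qed.

Lemma dim_flat_ge (S : {set I}) : (\dim {:V} <= #|S| + \dim (flat S))%N.
Proof.
elim: {S}#|S| {-2}S (erefl #|S|) => [|k IHk] S cS.
  by rewrite (cards0_eq cS) flat0 leq_addl.
have /card_gt0P[i iS] : (0 < #|S|)%N by rewrite cS.
move: cS; rewrite (cardsD1 i) iS add1n => -[/IHk h].
apply: leq_trans h _; rewrite addSnnS leq_add2l -[in flat S](setD1K iS) flatU1 capvC.
have [hi|hi] := boolP (flat (S :\ i) <= lker (a i))%VS; last by rewrite -dim_capv_lker.
by rewrite (capv_idPl hi).
Qed.

Lemma card_walls_ge (P : {set I}) u : in_cone setT P u -> (\dim {:V} <= #|walls P|)%N.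
Proof. by move=> /flat_walls h; have := dim_flat_ge (walls P); rewrite h dimv0 addn0. Qed.

(** As few walls as possible form a basis of the dual space, and [e] is a vector of the dual basis
    of the oriented forms, spanning an extreme ray. It is found in the common kernel of the other
    walls, which is nonzero for reasons of dimension. *)
Lemma dual_ray (P : {set I}) u i : in_cone setT P u -> #|walls P| = \dim {:V} ->
  i \in walls P ->
  exists e, [/\ closed_cone P e, sgn_form P i e = 1 &
             forall j, j \in walls P -> j != i -> sgn_form P j e = 0].
Proof.
move=> uP cW iW.
have : (0 < \dim (flat (walls P :\ i)))%N.
  by have := dim_flat_ge (walls P :\ i); rewrite -cW (cardsD1 i) iW; lia.
rewrite lt0n dimv_eq0 -subv0 => /subvPn[e eW]; rewrite memv0 => e0.
have ej j : j \in walls P -> j != i -> sgn_form P j e = 0.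
  move=> jW ji; apply/eqP; rewrite sgn_form_eq0; apply: subvP eW.
  by apply: flat_sub_lker; rewrite in_setD1 ji.
have ei : sgn_form P i e != 0.
  apply: contra e0 => ei; rewrite -memv0 -(flat_walls uP) memvE; apply/subv_flatP => j jW.
  rewrite -memvE -(sgn_form_eq0 a P).
  by have [->//|ji] := eqVneq j i; rewrite ej.
pose c := (sgn_form P i e)^-1.
have ci : sgn_form P i (c *: e) = 1 by rewrite sgn_formZ mulVf.
have cj j : j \in walls P -> j != i -> sgn_form P j (c *: e) = 0.
  by move=> jW ji; rewrite sgn_formZ ej ?mulr0.
exists (c *: e); split => //; apply: (closed_cone_walls uP) => j jW.
by have [->|ji] := eqVneq j i; rewrite ?ci ?cj.
Qed.

(** Shows that walls alone cut out every face. Points of the closed cone are nonnegative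
    combinations of the rays [e i], and a form that is nonnegative on the cone vanishes at such a
    point only if it vanishes on every ray involved. *)
Lemma simplicial_face (P : {set I}) u (S : {set I}) :
  in_cone setT P u -> #|walls P| = \dim {:V} ->
  exists2 J : {set I}, J \subset walls P &
    forall v, closed_cone P v -> (v \in flat S) = (v \in flat J).
Proof.
move=> uP cW.
have /choice[e eP] : forall i, exists e, i \in walls P ->
    [/\ closed_cone P e, sgn_form P i e = 1 &
       forall j, j \in walls P -> j != i -> sgn_form P j e = 0].
  move=> i; have [iW|//] := boolP (i \in walls P); last by exists 0.
  by have [e he] := dual_ray uP cW iW; exists e.
have decomp v : v = \sum_(i in walls P) sgn_form P i v *: e i.
  apply/eqP; rewrite -subr_eq0 -memv0 -(flat_walls uP) memvE; apply/subv_flatP => j jW.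
  rewrite -memvE -(sgn_form_eq0 a P) sgn_formD sgn_formN.
  rewrite (big_morph (sgn_form P j) (sgn_formD a P j) (sgn_form0 a P j)).
  rewrite (bigD1 j) //= sgn_formZ; have [_ -> _] := eP j jW.
  rewrite big1 => [|i /andP[iW ij]]; first by rewrite mulr1 addr0 subrr.
  rewrite sgn_formZ; have [_ _ h] := eP i iW.
  by rewrite h ?mulr0 // eq_sym.
have sgn_decomp v s : sgn_form P s v = \sum_(i in walls P) sgn_form P i v * sgn_form P s (e i).
  rewrite {1}(decomp v) (big_morph (sgn_form P s) (sgn_formD a P s) (sgn_form0 a P s)).
  by apply: eq_bigr => i _; rewrite sgn_formZ.
(* These are the walls opposite the rays [e i] that are not contained in [flat S]. *)
exists [set i in walls P | [exists s in S, sgn_form P s (e i) != 0]].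
  by apply/subsetP => i; rewrite inE => /andP[].
move=> v vP; rewrite !memvE; apply/subv_flatP/subv_flatP.
  move=> vS i; rewrite inE => /andP[iW /exists_inP[s sS esi]].
  rewrite -memvE -(sgn_form_eq0 a P).
  have := vS s sS; rewrite -memvE -(sgn_form_eq0 a P) sgn_decomp psumr_eq0; last first.
    by move=> k kW; rewrite mulr_ge0 //; have [] := eP k kW.
  move=> /allP /(_ i (mem_index_enum i)); rewrite iW /= mulf_eq0 => /orP[//|h].
  by rewrite h in esi.
move=> vJ s sS; rewrite -memvE -(sgn_form_eq0 a P) sgn_decomp big1 // => i iW.
have [->|esi] := eqVneq (sgn_form P s (e i)) 0; first by rewrite mulr0.
have := vJ i; rewrite inE iW /= -memvE -(sgn_form_eq0 a P) => h.
rewrite (eqP (h _)) ?mul0r //; apply/exists_inP; by exists s.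
Qed.

End Walls.

(** * Chambers as projectivized open cones *)

Section ProjectivePoints.
Variable R : realType.
Local Notation V := 'rV[R]_4.

Definition pt (v : punctured R) : P3 R := onedim_pi v.

Definition mkpunct (v : V) (v0 : v != 0) : punctured R := exist _ v (mem_set v0).

Lemma punct_neq0 (v : punctured R) : val v != 0.
Proof. by case: v => v /= /set_mem. Qed.

Lemma pt_surj (x : P3 R) : exists v, x = pt v.
Proof. by exists (onedim_repr x); rewrite /pt onedim_reprK. Qed.

Lemma pt_eqP (v w : punctured R) :
  pt v = pt w <-> exists2 c, c != 0 & val w = c *: val v.
Proof.
split=> [/(congr1 (@subspace_of R)) vw|[c c0 wv]].
  have /vlineP[c wc] : val w \in <[val v : V]>%VS by have := memv_line (val w : V); rewrite -[<[_]>%VS]vw.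
  exists c => //; apply: contraTneq (punct_neq0 w) => c0.
  by rewrite wc c0 scale0r eqxx.
apply: (@val_inj _ _ (onedim R)); apply/eqP; rewrite /= eqEdim !dim_vline !punct_neq0 leqnn andbT.
apply/vlineP => /=; exists c^-1.
by rewrite wv scalerA mulVf // scale1r.
Qed.

Lemma projectivization_pt (W : {vspace V}) v : projectivization W (pt v) = (val v \in W) :> Prop.
Proof. by rewrite /projectivization /= memvE. Qed.

Lemma openP3 (U : set (P3 R)) : open U = open (pt @^-1` U).
Proof.
(* The quotient topology is stated through the locked projection [pi], which unfolds to [pt]. *)
have -> : pt = generic_quotient.pi (P3 R) by rewrite generic_quotient.pi.unlock.
by [].
Qed.

Lemma pt_continuous : continuous pt.
Proof. by apply/continuousP => U; rewrite openP3. Qed.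

Lemma val_punct_continuous : continuous (val : punctured R -> V).
Proof. exact: initial_continuous. Qed.

(** The cones of interest are not stable under negation, so one suitable representative suffices; it
    is nonzero, which discards the apex of a closed cone. *)
Definition proj (Q : V -> Prop) : set (P3 R) := [set x | exists2 v, x = pt v & Q (val v)].

Lemma proj_pt (Q : V -> Prop) v : proj Q (pt v) <-> exists2 c : R, c != 0 & Q (c *: val v).
Proof.
split=> [[w /pt_eqP[c c0 wE] Qw]|[c c0 Qc]]; first by exists c; rewrite -?wE.
have cv0 : c *: val v != 0 by rewrite scaler_eq0 negb_or c0 punct_neq0.
by exists (mkpunct cv0) => //; apply/pt_eqP; exists c.
Qed.

Lemma hom_continuous (f : 'Hom(V, R^o)) : continuous (f : V -> R).
Proof.
have -> : (f : V -> R) = \sum_(j < 4) (fun v : V => v 0 j * (f (delta_mx 0 j) : R)).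
  apply/funext => v; rewrite fct_sumE {1}[v]row_sum_delta.
  rewrite (linear_sum (f : {linear V -> R^o})); apply: eq_bigr => j _; exact: homZ.
move=> v; elim/big_ind : _ => [|g h|j _].
- exact: cst_continuous.
- exact: continuousD.
- apply: (@continuousM _ _ (fun v : V => v 0 j) (cst (f (delta_mx 0 j) : R))).
    exact: coord_continuous.
  exact: cst_continuous.
Qed.

Lemma path_continuous (w : R -> V) (w0 : forall s, w s != 0) :
  continuous w -> continuous (fun s => pt (mkpunct (w0 s))).
Proof.
move=> wc s; apply: continuous_comp; last exact: pt_continuous.
have hc : continuous (fun s => mkpunct (w0 s)) by apply: continuous_comp_initial.
exact: hc.
Qed.

End ProjectivePoints.

Section Chambers.
Variables (R : realType) (n : nat) (A : arrangement R n).
Local Notation V := 'rV[R]_4.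
Local Notation sgn_form := (sgn_form A).
Local Notation in_cone := (in_cone A [set: 'I_n]%SET).
Local Notation closed_cone := (closed_cone A).

Hypothesis flatT : flat A [set: 'I_n]%SET = 0%VS.

(** The empty family has the nonzero common kernel [V]. The existence of a form keeps the origin out
    of the open cones. *)
Lemma inhabited_ord : exists i : 'I_n, True.
Proof.
apply: contrapT => /forallNP h.
have /eqP/matrixP/(_ 0 0) : (const_mx 1 : V) == 0.
  rewrite -memv0 -flatT memvE; apply/subv_flatP => i; exfalso; exact: h i I.
by rewrite !mxE => /eqP; rewrite oner_eq0.
Qed.

Lemma complement_pt v : complement A (pt v) <-> forall i, (A i (val v) : R) != 0.
Proof.
split=> [h i|h [i _]].
  apply/eqP => vi; apply: h; exists i => //.
  by rewrite /plane projectivization_pt memv_ker; apply/eqP.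
by rewrite /plane projectivization_pt memv_ker => /eqP vi; have := h i; rewrite vi eqxx.
Qed.

Lemma sgn_form_continuous P i : continuous (sgn_form P i).
Proof.
have -> : sgn_form P i = if i \in P then (A i : V -> R) else (fun v => - (A i v : R)).
  by apply/funext => v; rewrite sgn_formE; case: ifP.
case: ifP => _ v; first exact: hom_continuous.
by apply: continuousN; exact: hom_continuous.
Qed.

Lemma open_in_cone P : open [set v : V | in_cone P v].
Proof.
rewrite openE => v vP; rewrite /interior.
have : \forall w \near v, forall i, 0 < sgn_form P i w.
  apply: (@filter_forall V 'I_n (fun i w => 0 < sgn_form P i w) (nbhs v)) => i.
  apply: (@sgn_form_continuous P i v [set x : R | 0 < x]).
  by apply: open_nbhs_nbhs; split; [exact: open_gt | exact: vP (finset.in_setT _)].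
by apply: filterS => w h i _.
Qed.

Lemma closed_closed_cone P : closed [set v : V | closed_cone P v].
Proof.
have -> : [set v : V | closed_cone P v] =
    \bigcap_(i in [set: 'I_n]) (sgn_form P i @^-1` [set x : R | 0 <= x]).
  by apply/seteqP; split => v h i; [move=> _; exact: h | exact: (h i Logic.I)].
apply: closed_bigI => i _; apply: preimage_closed; last exact: closed_ge.
by move=> ? _; apply: sgn_form_continuous.
Qed.

(** Cones are stable under positive scaling, so only the sign of the scalar between two
    representatives matters. *)
Lemma proj_in_cone_pt P v :
  proj (in_cone P) (pt v) <-> in_cone P (val v) \/ in_cone P (- val v).
Proof.
split=> [/proj_pt[c c0 h]|[h|h]].
- case: (ltgtP c 0) c0 => // c0 _; [right|left] => i iT; have := h i iT.
    by rewrite sgn_formZ nmulr_rgt0 // sgn_formN oppr_gt0.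
  by rewrite sgn_formZ pmulr_rgt0.
- by apply/proj_pt; exists 1; rewrite ?oner_eq0 // scale1r.
- by apply/proj_pt; exists (-1); rewrite ?oppr_eq0 ?oner_eq0 // scaleN1r.
Qed.

Lemma proj_closed_cone_pt P v :
  proj (closed_cone P) (pt v) <-> closed_cone P (val v) \/ closed_cone P (- val v).
Proof.
split=> [/proj_pt[c c0 h]|[h|h]].
- case: (ltgtP c 0) c0 => // c0 _; [right|left] => i; have := h i.
    by rewrite sgn_formZ nmulr_rge0 // sgn_formN oppr_ge0.
  by rewrite sgn_formZ pmulr_rge0.
- by apply/proj_pt; exists 1; rewrite ?oner_eq0 // scale1r.
- by apply/proj_pt; exists (-1); rewrite ?oppr_eq0 ?oner_eq0 // scaleN1r.
Qed.

Lemma open_proj_in_cone P : open (proj (in_cone P)).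
Proof.
rewrite openP3.
have -> : @pt R @^-1` proj (in_cone P) =
    val @^-1` ([set v : V | in_cone P v] `|` -%R @^-1` [set v : V | in_cone P v]).
  by apply/seteqP; split => v /=; rewrite proj_in_cone_pt.
apply: open_comp => [v _|]; first exact: val_punct_continuous.
apply: openU; first exact: open_in_cone.
apply: open_comp => [v _|]; [exact: opp_continuous | exact: open_in_cone].
Qed.

Lemma closed_proj_closed_cone P : closed (proj (closed_cone P)).
Proof.
rewrite -openC openP3.
have -> : @pt R @^-1` (~` proj (closed_cone P)) =
    ~` (val @^-1` ([set v : V | closed_cone P v] `|` -%R @^-1` [set v : V | closed_cone P v])).
  by apply/seteqP; split => v /=; rewrite proj_closed_cone_pt.
rewrite openC; apply: preimage_closed => [v _|]; first exact: val_punct_continuous.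
apply: closedU; first exact: closed_closed_cone.
apply: preimage_closed => [v _|]; [exact: opp_continuous | exact: closed_closed_cone].
Qed.

Lemma proj_in_cone_complement P : proj (in_cone P) `<=` complement A.
Proof.
move=> _ [v -> h]; apply/complement_pt => i.
have := lt0r_neq0 (h i (finset.in_setT _)).
by rewrite sgn_form_eq0 memv_ker.
Qed.

(** No form vanishes off the planes, so weak inequalities become strict there. Hence projectivized
    open cones are also relatively closed in the complement. *)
Lemma complement_closed_cone P :
  complement A `&` proj (closed_cone P) = complement A `&` proj (in_cone P).
Proof.
apply/seteqP; split=> x [xA [v xv h]]; split=> //; exists v => // i.
  rewrite xv in xA; move=> _; rewrite lt_neqAle h andbT eq_sym sgn_form_eq0 memv_ker.
  by move/complement_pt: xA.
exact: ltW (h i (finset.in_setT _)).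
Qed.

(* The path [s^2 u + (1 - s)^2 v] stays in the cone for all real [s]. *)
Lemma proj_in_cone_connected P v : in_cone P (val v) ->
  proj (in_cone P) `<=` connected_component (complement A) (pt v).
Proof.
move=> vP _ [u -> uP].
pose w (s : R) : V := (s ^+ 2) *: val u + ((1 - s) ^+ 2) *: val v.
have wP s : in_cone P (w s).
  move=> i iT; rewrite /w sgn_formD !sgn_formZ.
  have ui := uP i iT; have vi := vP i iT.
  have [->|s0] := eqVneq s 0; first by rewrite expr0n /= mul0r add0r subr0 expr1n mul1r.
  rewrite ltr_pwDl //; first by rewrite mulr_gt0 // exprn_even_gt0.
  by rewrite mulr_ge0 ?sqr_ge0 // ltW.
have w0 s : w s != 0.
  have [i _] := inhabited_ord; apply: contraTneq (wP s i (finset.in_setT _)) => ->.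
  by rewrite sgn_form0 ltxx.
pose g s := pt (mkpunct (w0 s)).
have gc : continuous g.
  apply: path_continuous => s.
  apply: (@continuousD _ _ _ (fun s : R => s ^+ 2 *: val u) (fun s : R => (1 - s) ^+ 2 *: val v)).
    by apply: continuousZr_tmp; exact: exprn_continuous.
  apply: continuousZr_tmp.
  apply: (@continuous_comp _ _ _ (fun s : R => 1 - s) (fun s : R => s ^+ 2)).
    by apply: cvgB; [exact: cvg_cst | exact: cvg_id].
  exact: exprn_continuous.
have -> : pt u = g 1.
  apply/pt_eqP; exists 1; rewrite ?oner_eq0 // scale1r /= /w.
  by rewrite expr1n scale1r subrr expr0n /= scale0r addr0.
have gC s : proj (in_cone P) (g s) by exists (mkpunct (w0 s)); last exact: wP.
apply: (@connected_component_max _ _ (range g)).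
- exists 0 => //; apply/esym/pt_eqP; exists 1; rewrite ?oner_eq0 // scale1r /= /w.
  by rewrite expr0n /= scale0r subr0 expr1n scale1r add0r.
- by move=> _ [s _ <-]; apply: proj_in_cone_complement.
- apply: connected_continuous_connected; last exact: continuous_subspaceT.
  by apply/connected_intervalP => x y _ _ z.
- by exists 1.
Qed.

(** The cone meets the connected component in a nonempty, relatively open and relatively closed
    subset, hence contains it. *)
Lemma connected_component_proj P v : in_cone P (val v) ->
  connected_component (complement A) (pt v) = proj (in_cone P).
Proof.
move=> vP; apply/seteqP; split; last exact: proj_in_cone_connected.
set C := connected_component _ _; have CA : C `<=` complement A by exact: connected_component_sub.
have Cv : proj (in_cone P) (pt v) by exists v.
suff <- : C `&` proj (in_cone P) = C by apply: subIsetr.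
apply: (@component_connected _ (complement A) (pt v)).
- exists (pt v); split => //; apply: connected_component_refl.
  exact: proj_in_cone_complement Cv.
- by exists (proj (in_cone P)) => //; exact: open_proj_in_cone.
- exists (proj (closed_cone P)); first exact: closed_proj_closed_cone.
  rewrite -/C -{1 2}(setIidl CA) -!setIA.
  by rewrite complement_closed_cone.
Qed.

Lemma in_cone_neq0 P v : in_cone P v -> v != 0.
Proof.
have [i _] := inhabited_ord; move=> /(_ i (finset.in_setT _)); apply: contraTneq => ->.
by rewrite sgn_form0 ltxx.
Qed.

(** A chamber is coded by the signs of the forms at a representative. The complementary code gives
    the same chamber, so regions of [V] count chambers twice. *)
Lemma chamberP C : chamber A C <->
  exists2 P, (exists v, in_cone P v) & C = proj (in_cone P).
Proof.
split=> [[x xA ->]|[P [v vP] ->]].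
  have [v xv] := pt_surj x; rewrite xv in xA *.
  pose P := [set i | 0 < (A i (val v) : R)]%SET.
  have vP : in_cone P (val v).
    move=> i _; rewrite sgn_formE inE; case: ifP => // /negbT; rewrite -leNgt => h.
    by rewrite oppr_gt0 lt_neqAle h andbT; move/complement_pt: xA.
  by exists P; [exists (val v) | exact: connected_component_proj].
exists (pt (mkpunct (in_cone_neq0 vP))).
  by apply: (@proj_in_cone_complement P); exists (mkpunct (in_cone_neq0 vP)).
by rewrite (@connected_component_proj P).
Qed.

Lemma closure_proj_in_cone P u : in_cone P u ->
  closure (proj (in_cone P)) = proj (closed_cone P).
Proof.
move=> uP; apply/seteqP; split.
  rewrite (closure_id (proj (closed_cone P))).1; last exact: closed_proj_closed_cone.
  apply: closureS => _ [v -> h]; exists v => // i; exact: ltW (h i (finset.in_setT _)).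
move=> _ [v -> vP].
(* The square keeps the coefficient of [u] positive for every nonzero [s], so the path enters the
   open cone on both sides of 0. *)
pose w (s : R) : V := val v + s ^+ 2 *: u.
have wP s : s != 0 -> in_cone P (w s).
  move=> s0 i iT; rewrite sgn_formD sgn_formZ ltr_wpDl // mulr_gt0 ?uP //.
  by rewrite exprn_even_gt0.
have w0 s : w s != 0.
  have [->|s0] := eqVneq s 0; last exact: in_cone_neq0 (wP s s0).
  by rewrite /w expr0n /= scale0r addr0 punct_neq0.
have wc : continuous w.
  move=> s; apply: (@continuousD _ _ _ (cst (val v)) (fun s : R => s ^+ 2 *: u)).
    exact: cst_continuous.
  by apply: continuousZr_tmp; exact: exprn_continuous.
have -> : pt v = pt (mkpunct (w0 0)).
  apply/pt_eqP; exists 1; rewrite ?oner_eq0 // scale1r /= /w.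
  by rewrite expr0n /= scale0r addr0.
have gc := path_continuous (w0 := w0) wc.
move=> B /gc /nbhs_ballP[e /= e0 eB].
exists (pt (mkpunct (w0 (e / 2)))); split.
  exists (mkpunct (w0 (e / 2))) => //; apply: wP; by rewrite lt0r_neq0 // divr_gt0.
apply: eB; rewrite /ball /= sub0r normrN gtr0_norm ?divr_gt0 // ltr_pdivrMr //.
by rewrite mulr_natr mulr2n ltrDr.
Qed.

End Chambers.

(** * Chambers with four walls are the tetrahedra *)

Lemma bigcap_plane (R : realType) (n : nat) (A : arrangement R n) (S : set 'I_n) :
  \bigcap_(i in S) plane (A i) = projectivization (flat A [set i | `[< S i >]]%SET).
Proof.
apply/seteqP; split=> x.
  by move=> h; apply/subv_flatP => i; rewrite inE => /asboolP; apply: h.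
by move=> /subv_flatP h i Si; apply: h; rewrite inE; apply/asboolP.
Qed.

Section Faces.
Import fintype boot.finset.
Variables (R : realType) (n : nat) (A : arrangement R n).
Local Notation V := 'rV[R]_4.
Local Notation sgn_form := (sgn_form A).
Local Notation in_cone := (in_cone A [set: 'I_n]%SET).
Local Notation closed_cone := (closed_cone A).
Local Notation walls := (walls A).

Lemma dim_rV4 : \dim {:V} = 4%N.
Proof. by rewrite dimvf dim_matrix. Qed.

Lemma lker_form_inj : injective (fun i => lker (A i)).
Proof. by move=> i j ij; apply: (@form_distinct _ _ A); rewrite /plane ij. Qed.

Lemma lker_form_incomp i j : i != j -> ~~ (lker (A i) <= lker (A j))%VS.
Proof.
move=> ij; apply: contra ij => ij; apply/eqP/lker_form_inj/eqP.
by rewrite eqEdim ij !(dim_lker dim_rV4) //; apply: form_neq0.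
Qed.

Hypothesis flatT : flat A [set: 'I_n]%SET = 0%VS.

Definition face (P S : {set 'I_n}) : set (P3 R) :=
  proj (fun v => closed_cone P v /\ v \in flat A S).

Lemma face_pt P S v : closed_cone P (val v) -> face P S (pt v) <-> val v \in flat A S.
Proof.
move=> vP; split=> [/proj_pt[c c0 [_ h]]|h]; last by exists v.
by rewrite -[val v](scalerK c0) memvZ.
Qed.

Lemma faces_proj_in_cone P u : in_cone P u -> faces A (proj (in_cone P)) = range (face P).
Proof.
move=> uP; have faceE (S : {set 'I_n}) :
    closure (proj (in_cone P)) `&` projectivization (flat A S) = face P S.
  rewrite (closure_proj_in_cone flatT uP); apply/seteqP; split=> x.
    by move=> [[v -> vP]]; rewrite projectivization_pt => vS; exists v.
  by move=> [v -> [vP vS]]; split; [exists v | rewrite projectivization_pt].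
apply/seteqP; split=> F [S _ <-].
  by exists [set i | `[< S i >]]%SET => //; rewrite bigcap_plane faceE.
exists [set` S] => //; rewrite bigcap_plane.
rewrite (_ : [set i | _]%SET = S) ?faceE //.
by apply/setP => i; rewrite inE; apply/asboolP/idP.
Qed.

(** By [simplicial_face], subsets of the four walls produce all faces; the dual rays show that
    distinct subsets produce distinct faces. *)
Lemma simplicial_cone_tetrahedron P u : in_cone P u -> #|walls P| = 4%N ->
  combinatorial_tetrahedron A (proj (in_cone P)).
Proof.
move=> uP cW.
have cW' : #|walls P| = \dim {:V} by rewrite cW dim_rV4.
pose g (k : 'I_4) : 'I_n := enum_val (cast_ord (esym cW) k).
have g_inj : injective g by move=> k l /enum_val_inj /cast_ord_inj.
have gW k : g k \in walls P by apply: enum_valP.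
have g_surj i : i \in walls P -> exists k, i = g k.
  move=> iW; exists (cast_ord cW (enum_rank_in iW i)).
  by rewrite /g cast_ordK enum_rankK_in.
(* The index [k] stands for the vertex opposite the wall [g k]; the face with vertex set [K] lies on
   the walls opposite the other vertices. *)
pose phi (K : {set 'I_4}) := face P (g @: ~: K)%SET.
exists phi; split.
  rewrite (faces_proj_in_cone uP); apply/seteqP; split=> F [S _ <-]; first by exists (g @: ~: S)%SET.
  have [J JW hJ] := simplicial_face lker_form_incomp flatT S uP cW'.
  exists (~: (g @^-1: J))%SET => //; rewrite /phi setCK.
  have -> : (g @: (g @^-1: J))%SET = J.
    apply/setP => i; apply/imsetP/idP => [[k]|iJ]; first by rewrite inE => ? ->.
    by have [k ik] := g_surj i (subsetP JW _ iJ); exists k => //; rewrite inE -ik.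
  by apply/seteqP; split=> x [v -> [vP vS]]; exists v => //; split=> //; move: vS; rewrite hJ.
move=> K L; split=> [KL|KL]; last first.
  move=> x [v -> [vP vS]]; exists v => //; split=> //; move: vS.
  rewrite !memvE => /subv_trans; apply; apply: flatS; apply: imsetS; by rewrite setCS.
apply/subsetP => k kK; apply: contraT => kL.
(* The vertex opposite [g k] lies on all the other walls, hence in [phi K], but not on [g k], hence
   not in [phi L]. *)
have [e [eP ek ej]] := dual_ray lker_form_incomp flatT uP cW' (gW k).
have e0 : e != 0 by apply: contra_eq_neq ek => ->; rewrite sgn_form0 eq_sym oner_eq0.
have /KL : phi K (pt (mkpunct e0)).
  apply/face_pt => //=; rewrite memvE; apply/subv_flatP => i /imsetP[l lK ->].
  rewrite -memvE -(sgn_form_eq0 A P) ej ?gW //.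
  by apply: contraTneq lK => /g_inj ->; rewrite inE kK.
move=> /face_pt => /(_ eP) /=; rewrite memvE => /subv_flatP /(_ (g k)).
rewrite imset_f ?inE // => /(_ isT); rewrite -memvE -(sgn_form_eq0 A P) ek.
by rewrite oner_eq0.
Qed.

(* The facets of distinct walls are distinct coatoms of the face poset, and the
   poset of subsets of 'I_4 has only four coatoms. *)
Lemma tetrahedron_simplicial_cone P u : in_cone P u ->
  combinatorial_tetrahedron A (proj (in_cone P)) -> (#|walls P| <= 4)%N.
Proof.
move=> uP [phi []]; rewrite (faces_proj_in_cone uP) => rphi phiS.
have facephi S : exists K, phi K = face P S.
  by have [K _ KE] : range phi (face P S) by [rewrite rphi; exists S]; exists K.
have phiface K : exists S, phi K = face P S.
  by have [S _ SE] : range (face P) (phi K) by [rewrite -rphi; exists K]; exists S.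
have faceS (S T : {set 'I_n}) : T \subset S -> face P S `<=` face P T.
  move=> TS x [v -> [vP vS]]; exists v => //; split=> //; move: vS.
  by rewrite !memvE => /subv_trans; apply; apply: flatS.
have phiT : phi [set: 'I_4]%SET = face P set0.
  have [K KE] := facephi set0; have [S SE] := phiface [set: 'I_4]%SET.
  apply/seteqP; split; first by rewrite SE; apply: faceS; rewrite sub0set.
  by rewrite -KE; apply/phiS; apply: subsetT.
(* A point in the relative interior of the facet [i] lies on no other plane, so the only faces
   through it are this facet and the whole closed chamber. *)
have [v0 v0P] : exists v, forall i, i \in walls P -> closed_cone P (val (v i)) /\
    forall S : {set 'I_n}, face P S (pt (v i)) <-> S \subset [set i]%SET.
  suff /choice[v] : forall i, exists v, i \in walls P -> closed_cone P (val v) /\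
    forall S : {set 'I_n}, face P S (pt v) <-> S \subset [set i]%SET by exists v.
  move=> i; have [iW|iW] := boolP (i \in walls P); last by exists (mkpunct (in_cone_neq0 flatT uP)).
  have [w wi wP] := walls_witness iW.
  have wP' : closed_cone P w.
    move=> j; have [->|ji] := eqVneq j i; first by move: wi; rewrite -(sgn_form_eq0 A P) => /eqP ->.
    by apply/ltW/wP; rewrite !inE ji.
  have w0 : w != 0.
    (* There are at least four walls, hence an index other than [i], whose strict inequality
       excludes the origin. *)
    apply/eqP => w0; have : (1 < #|walls P|)%N.
      have := card_walls_ge lker_form_incomp flatT uP.
      by rewrite dim_rV4; apply: leq_trans.
    move=> /card_gt1P[j [k [_ _ jk]]].
    have [l li] : exists l, l != i.
      by have [ji|ji] := eqVneq j i; [exists k; rewrite -ji eq_sym | exists j].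
    by have := wP l; rewrite !inE li w0 sgn_form0 ltxx => /(_ isT).
  exists (mkpunct w0) => _; split=> // S; split.
    move=> /face_pt => /(_ wP') /=; rewrite memvE => /subv_flatP wS.
    apply/subsetP => j jS; rewrite inE; apply: contraT => ji.
    have := wP j; rewrite !inE ji => /(_ isT) /lt0r_neq0.
    by rewrite sgn_form_eq0 memvE wS.
  move=> Si; apply/face_pt => //=; rewrite memvE; apply/subv_flatP => j /(subsetP Si).
  by rewrite inE => /eqP ->; rewrite -memvE.
have [k kP] : exists k : 'I_n -> 'I_4, forall i, i \in walls P ->
    phi (~: [set k i])%SET = face P [set i]%SET.
  suff /choice[k] : forall i, exists k : 'I_4, i \in walls P ->
    phi (~: [set k])%SET = face P [set i]%SET by exists k.
  move=> i; have [iW|iW] := boolP (i \in walls P); last by exists ord0.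
  have [vP vS] := v0P i iW; have [K KE] := facephi [set i]%SET.
  (* If [K] were everything, the facet would be the whole closed chamber and contain the interior
     point [u]. *)
  have [KT|/subsetPn[j _ jK]] := boolP ([set: 'I_4]%SET \subset K).
    have /phiS : ([set: 'I_4]%SET \subset K) by [].
    have ui : face P set0 (pt (mkpunct (in_cone_neq0 flatT uP))).
      apply/face_pt => /= [j|]; first by apply/ltW/uP; rewrite inE.
      by rewrite flat0 memvf.
    rewrite phiT KE => /(_ _ ui) /face_pt => /(_ _) /=.
    have uP' : closed_cone P u by move=> j; apply/ltW/uP; rewrite inE.
    rewrite flat1 -(sgn_form_eq0 A P) => /(_ uP') /eqP ui0.
    by have := uP i; rewrite inE ui0 ltxx => /(_ isT).
  exists j => _; suff -> : (~: [set j])%SET = K by [].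
  apply/setP => l; rewrite !inE; apply/idP/idP; last by apply: contraTneq => ->.
  move=> lj; apply: contraT => lK.
  (* If [K] missed [l] besides [j], then [l |: K] would code a face strictly between the facet and
     the whole chamber. But this face contains [v0 i], so it is one of the two. *)
  have [S SE] := phiface (l |: K)%SET.
  have /vS Si : face P S (pt (v0 i)).
    have /phiS sub : K \subset (l |: K)%SET by apply: subsetU1.
    by rewrite -SE; apply: sub; rewrite KE; apply/vS.
  have [iS|iS] := boolP (i \in S).
    have Si' : S = [set i]%SET by apply/eqP; rewrite eqEsubset Si sub1set.
    have : (l |: K)%SET \subset K by apply/phiS; rewrite SE Si' KE.
    by move=> /subsetP /(_ l (setU11 _ _)); rewrite (negbTE lK).
  have S0 : S = set0.
    apply/eqP; rewrite -subset0; apply/subsetP => m mS.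
    by move: (subsetP Si m mS); rewrite inE => /eqP mi; rewrite -mi mS in iS.
  have : [set: 'I_4]%SET \subset (l |: K)%SET by apply/phiS; rewrite SE S0 phiT.
  move=> /subsetP /(_ j (in_setT _)); rewrite !inE (negbTE jK) orbF eq_sym.
  by rewrite (negbTE lj).
have k_inj : {in walls P &, injective k}.
  move=> i j iW jW kij; have [_ viS] := v0P i iW.
  have /viS : face P [set j]%SET (pt (v0 i)) by rewrite -kP // -kij kP //; apply/viS.
  by rewrite sub1set inE => /eqP.
by rewrite -(card_in_imset k_inj); apply: leq_trans (max_card _) _; rewrite card_ord.
Qed.

Lemma simplicial_walls : simplicial A <->
  forall P, P \in regions A fullv [set: 'I_n]%SET -> #|walls P| = 4%N.
Proof.
split=> [hA P /regions_setTP[u uP]|hA C /(chamberP flatT)[P [u uP] ->]]; last first.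
  apply: (simplicial_cone_tetrahedron uP); apply: hA; apply/regions_setTP; by exists u.
apply/eqP; rewrite eqn_leq; apply/andP; split.
  apply: (tetrahedron_simplicial_cone uP); apply: hA; apply/(chamberP flatT).
  by exists P => //; exists u.
by have := card_walls_ge lker_form_incomp flatT uP; rewrite dim_rV4.
Qed.

(** The sum of [#|walls P| - 4] over all regions is -4 times the defect. Its terms are nonnegative,
    so it vanishes exactly when all of them do. *)
Lemma simplicial_defect : simplicial A <-> euler_defect A = 0.
Proof.
rewrite simplicial_walls.
have n4 : (4 <= n)%N.
  have := dim_flat_ge A [set: 'I_n]%SET; rewrite flatT dimv0 addn0 cardsT card_ord.
  by rewrite dim_rV4.
have := sum_regions_weight dim_rV4 (form_neq0 A).
have I1 : (1 < #|'I_n|)%N by rewrite card_ord; apply: leq_trans n4.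
rewrite (euler_defectE dim_rV4 (form_neq0 A) lker_form_inj I1).
have := sum_card_walls (form_neq0 A).
set S := (\sum_i _)%N; have -> : (\sum_i #|regions A (lker (A i)) ([set: 'I_n] :\ i)%SET|%:Z) = S%:Z.
  by rewrite /S; elim/big_rec2 : _ => // i x y _ ->; rewrite PoszD.
set W := (\sum_(P in _) _)%N; set r := #|regions _ _ _| => WS rS.
have W4 : (4 * r <= W ?= iff [forall (P | P \in regions A fullv [set: 'I_n]%SET), #|walls P| == 4])%N.
  rewrite mulnC -sum_nat_const.
  have h P : P \in regions A fullv [set: 'I_n]%SET -> (4 <= #|walls P| ?= iff (#|walls P| == 4))%N.
    move=> /regions_setTP[u uP]; split; last by rewrite eq_sym.
    by have := card_walls_ge lker_form_incomp flatT uP; rewrite dim_rV4.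
  by have := leqif_sum h.
have -> : euler_defect A = 0 <-> (4 * r = W)%N.
  move: (euler_defect A) WS rS {W4} => e; clearbody W S r => WS rS; split; lia.
case: W4 => _ W4; split=> [h|/eqP]; last by rewrite W4 => /forall_inP h P /h /eqP.
by apply/eqP; rewrite W4; apply/forall_inP => P /h ->.
Qed.

End Faces.

(** Translates essentiality for use with cones: a vector killed by a spanning family is killed by
    every covector, in particular by all coordinates. *)
Lemma span_forms_flat (R : realType) (V : vectType R) (n : nat) (a : 'I_n -> 'Hom(V, R^o)) :
  <<[seq a i | i : 'I_n]>>%VS = fullv -> flat a [set: 'I_n]%SET = 0%VS.
Proof.
move=> spanT; apply/eqP; rewrite -subv0; apply/subvP => v /[!memvE] /subv_flatP vT.
rewrite -memvE memv0; apply/eqP.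
have f0 (f : 'Hom(V, R^o)) : (f v : R) = 0.
  have : f \in <<[seq a i | i : 'I_n]>>%VS by rewrite spanT memvf.
  move=> /(coord_span (X := in_tuple _)) ->; rewrite sum_lfunE big1 // => k _.
  rewrite scale_lfunE; have /mapP[i _ ->] : [seq a i | i : 'I_n]`_k \in [seq a i | i : 'I_n].
    exact: mem_nth.
  have := vT i (finset.in_setT _); rewrite -memvE memv_ker => /eqP ->; exact: scaler0.
rewrite (coord_vbasis (memvf v)) big1 // => k _.
have := f0 (linfun (coord (vbasis fullv) k : V -> R^o)); rewrite lfunE /= => ->.
exact: scale0r.
Qed.

(** * Counting vertices and incident pairs *)

(** The enumeration proves finiteness, which rules out the default value of [fset_set], and gives
    the cardinality as well. *)
Lemma card_fset_set_seq (U : choiceType) (s : seq U) (X : set U) :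
  uniq s -> (forall x, X x <-> x \in s) -> #|` fset_set X|%fset = size s.
Proof.
move=> us Xs; have finX : finite_set X.
  by have -> : X = [set` s] by [apply/seteqP; split => x /Xs]; exact: finite_seq.
apply/perm_size/uniq_perm; [exact: fset_uniq | by [] | move=> x].
rewrite in_fset_set //; apply/idP/idP => [/set_mem /Xs //|xs].
by apply/mem_set/Xs.
Qed.

(** The elements of [B] are grouped by the value of [c]. Values below 3 are absent on the left,
    hence the condition on [G]. *)
Lemma fsbig_card (T : finType) (B : {set T}) (c : T -> nat) (G : nat -> int) :
  (forall x, x \in B -> (c x < 3)%N -> G (c x) = 0) ->
  \sum_(p \in [set p : nat | (3 <= p)%N]) G p * #|[set x in B | c x == p]%SET|%:Z =
  \sum_(x in B) G (c x).
Proof.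
move=> G0; pose N := (\max_(x in B) c x).+1.
pose r := [seq p <- iota 0 N | (3 <= p)%N].
have cN x : x \in B -> (c x < N)%N by move=> xB; rewrite ltnS leq_bigmax_cond.
(* As [c] is bounded by [N] on [B], the terms from [N] on vanish and the sum becomes finite. *)
rewrite -(@fsbig_widen _ _ _ _ [set` r]); last 2 first.
- by move=> p /=; rewrite mem_filter => /andP[].
- move=> p [/= p3]; rewrite mem_filter p3 mem_iota /= add0n => pN.
  rewrite eq_card0 ?mulr0 // => x; rewrite !inE; apply/negP => /andP[xB /eqP cx].
  by apply: pN; rewrite -cx cN.
rewrite -fsbig_seq; last by apply: filter_uniq; apply: iota_uniq.
rewrite big_filter -[iota 0 N](_ : index_iota 0 N = _); last by rewrite /index_iota subn0.
rewrite big_mkord (bigID (fun x => (2 < c x)%N)) /= [X in _ = _ + X]big1 ?addr0; last first.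
  by move=> x /andP[xB]; rewrite -leqNgt; apply: G0.
rewrite (partition_big (fun x => inord (c x) : 'I_N) (fun p : 'I_N => 2 < p)%N) /=; last first.
  by move=> x /andP[xB x3]; rewrite inordK ?cN.
apply: eq_bigr => p p3.
rewrite (eq_bigr (fun=> G p)); last first.
  by move=> x /andP[/andP[xB _] /eqP <-]; rewrite inordK ?cN.
rewrite (eq_bigl (mem [set x in B | c x == p]%SET)) => [|x].
  by rewrite sumr_const -mulr_natr natz.
rewrite /= !inE; apply/andP/andP => [[/andP[xB _] /eqP <-]|[xB /eqP cp]].
  by rewrite inordK ?cN.
by rewrite xB cp p3 -val_eqE /= inordK ?cN ?cp.
Qed.

Section Counting.
Variables (R : realType) (n : nat) (A : arrangement R n).
Local Notation V := 'rV[R]_4.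

Lemma subspace_of_inj : injective (@subspace_of R).
Proof. by move=> x y xy; apply: (@val_inj _ _ (onedim R)). Qed.

Lemma dim_subspace_of (x : P3 R) : \dim (subspace_of x) = 1%N.
Proof. exact: eqP (svalP (x : onedim R)). Qed.

Lemma projectivizationS (W U : {vspace V}) :
  projectivization W `<=` projectivization U <-> (W <= U)%VS.
Proof.
split=> [WU|WU x /subv_trans]; last exact.
apply/subvP => v vW; have [->|v0] := eqVneq v 0; first exact: mem0v.
have := WU (pt (mkpunct v0)); rewrite !projectivization_pt; exact.
Qed.

Lemma projectivization_inj : injective (@projectivization R).
Proof.
move=> W U WU; apply/eqP; rewrite eqEsubv; apply/andP.
by split; apply/projectivizationS; rewrite WU.
Qed.

Lemma projectivization_subspace_of (x : P3 R) : projectivization (subspace_of x) = [set x].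
Proof.
apply/seteqP; split=> [y yx|_ -> ]; last exact: subvv.
by apply: subspace_of_inj; apply/eqP; rewrite eqEdim yx !dim_subspace_of.
Qed.

Lemma flatsP k F : reflect (flat_closure A F = F /\ \dim (flat A F) = k) (F \in flats A k).
Proof. by rewrite inE; apply: (iffP andP) => -[/eqP ? /eqP ?]. Qed.

(** The closure of any subfamily that cuts out the point serves as [F]; conversely, [F] itself cuts
    it out. *)
Lemma L3P (x : P3 R) :
  L3 A x <-> exists2 F, F \in flats A 1 & subspace_of x = flat A F.
Proof.
split=> [[S]|[F _ xF]].
  rewrite bigcap_plane -projectivization_subspace_of => /projectivization_inj xS.
  exists (flat_closure A [set i | `[< S i >]]%SET); last by rewrite flat_closureE.
  by apply/flatsP; rewrite flat_closureK flat_closureE -xS dim_subspace_of.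
exists [set` F]; rewrite bigcap_plane -projectivization_subspace_of xF; congr projectivization.
by congr flat; apply/setP => i; rewrite inE; apply/idP/asboolP.
Qed.

Lemma L2P (L : set (P3 R)) :
  L2 A L <-> exists2 F, F \in flats A 2 & L = projectivization (flat A F).
Proof.
split=> [[[W [dW LW]] [S LS]]|[F /flatsP[_ dF] LF]].
  exists (flat_closure A [set i | `[< S i >]]%SET); last first.
    by rewrite flat_closureE LS bigcap_plane.
  apply/flatsP; rewrite flat_closureK flat_closureE; split=> //.
  rewrite -[RHS]dW; congr (\dim _); apply: projectivization_inj.
  by rewrite -bigcap_plane -LS.
split; first by exists (flat A F).
exists [set` F]; rewrite bigcap_plane LF; congr projectivization.
by congr flat; apply/setP => i; rewrite inE; apply/idP/asboolP.
Qed.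

(** Since [F] is closed, it contains all the planes through the point, not merely enough of them to
    determine it. *)
Lemma nu_flat (x : P3 R) F : F \in flats A 1 -> subspace_of x = flat A F -> nu A x = #|F|.
Proof.
move=> /flatsP[clF _] xF; rewrite /nu -[in RHS]clF; apply: eq_card => i.
by rewrite !inE /plane /projectivization /= xF asboolb.
Qed.

Lemma line_mult_flat F : F \in flats A 2 -> line_mult A (projectivization (flat A F)) = #|F|.
Proof.
move=> /flatsP[clF _]; rewrite /line_mult -[in RHS]clF; apply: eq_card => i.
by rewrite !inE; apply/asboolP/idP => /projectivizationS.
Qed.

Lemma flats_inj k F G : F \in flats A k -> G \in flats A k -> flat A F = flat A G -> F = G.
Proof. by move=> /flatsP[cF _] /flatsP[cG _] FG; rewrite -cF -cG /flat_closure FG. Qed.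

Lemma exists_flat_point : exists f : {set 'I_n} -> P3 R,
  forall F, F \in flats A 1 -> subspace_of (f F) = flat A F.
Proof.
suff /choice[f fP] : forall F, exists x : P3 R, F \in flats A 1 -> subspace_of x = flat A F.
  by exists f.
move=> F.
have o0 : const_mx 1 != 0 :> V.
  by apply/eqP => /matrixP/(_ 0 0) /eqP; rewrite !mxE oner_eq0.
case: (boolP (F \in flats A 1)) => [/flatsP[_ /eqP dF]|_]; last by exists (pt (mkpunct o0)).
by exists (exist _ (flat A F) dF).
Qed.

Lemma t_pE p : t_p A p = #|[set F in flats A 1 | #|F| == p]%SET|.
Proof.
have [f fP] := exists_flat_point.
rewrite /t_p (@card_fset_set_seq _ [seq f F | F <- enum [set F in flats A 1 | #|F| == p]%SET]).
- by rewrite size_map cardE.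
- rewrite map_inj_in_uniq ?enum_uniq // => F G; rewrite !mem_enum !inE.
  rewrite -!andbA => /and3P[F1 F2 _] /and3P[G1 G2 _] FG.
  have hF : F \in flats A 1 by rewrite inE F1.
  have hG : G \in flats A 1 by rewrite inE G1.
  by apply: (flats_inj hF hG); rewrite -!fP // FG.
- move=> x; split=> [[/L3P[F F1 xF] nup]|/mapP[F]].
    apply/mapP; exists F; last by apply: subspace_of_inj; rewrite fP.
    by rewrite mem_enum inE F1 -nup (nu_flat F1 xF) /=.
  rewrite mem_enum inE => /andP[F1 /eqP Fp] ->; split; last by rewrite (nu_flat F1 (fP F F1)).
  by apply/L3P; exists F => //; apply: fP.
Qed.

Definition incidences : {set {set 'I_n} * {set 'I_n}} :=
  [set FL | [&& FL.1 \in flats A 1, FL.2 \in flats A 2 & FL.2 \subset FL.1]]%SET.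

(** Passing to flats reverses inclusion: a point is on a line exactly when all planes through the
    line contain the point. The conditions on [q] and [p] are nested so that the sum over [p] can be
    taken first. *)
Lemma t_pqE p q :
  t_pq A p q = #|[set FL in [set FL in incidences | #|FL.2| == q] | #|FL.1| == p]%SET|.
Proof.
have [f fP] := exists_flat_point.
pose g (FL : {set 'I_n} * {set 'I_n}) := (f FL.1, projectivization (flat A FL.2)).
set B := [set FL in _ | _]%SET.
have inB F L : ((F, L) \in B) =
    [&& F \in flats A 1, L \in flats A 2, L \subset F, #|F| == p & #|L| == q].
  by rewrite inE /= inE /= inE /= -!andbA; do !bool_congr; rewrite andbC.
rewrite /t_pq (@card_fset_set_seq _ [seq g FL | FL <- enum B]).
- by rewrite size_map cardE.
- rewrite map_inj_in_uniq ?enum_uniq // => -[F L] [G M]; rewrite !mem_enum !inB.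
  move=> /and5P[F1 L2 _ _ _] /and5P[G1 M2 _ _ _] [FG /projectivization_inj LM].
  rewrite (flats_inj L2 M2 LM); congr (_, _); apply: (flats_inj F1 G1).
  by rewrite -!fP // FG.
- move=> [x L] /=; split=> [[/= /L3P[F F1 xF] /L2P[M M2 ->] xL nup mq]|/mapP[[F M]]].
    apply/mapP; exists (F, M); last first.
      by rewrite /g /=; congr (_, _); apply: subspace_of_inj; rewrite fP.
    rewrite mem_enum inB F1 M2 -nup (nu_flat F1 xF) -mq (line_mult_flat M2) !eqxx !andbT /=.
    have [clF _] := flatsP _ _ F1; have [clM _] := flatsP _ _ M2.
    rewrite -clF -clM; apply/fintype.subsetP => i; rewrite !inE; apply: subv_trans.
    by rewrite -xF.
  rewrite mem_enum inB => /and5P[F1 M2 MF /eqP Fp /eqP Mq] [-> ->]; split => /=.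
  + by apply/L3P; exists F => //; apply: fP.
  + by apply/L2P; exists M.
  + by rewrite /projectivization /= fP // flatS.
  + by rewrite (nu_flat F1 (fP F F1)).
  + by rewrite line_mult_flat.
Qed.

(** Every vertex lies on at least three planes, so the range of [p] omits none. The range of [q]
    omits the double lines, whose coefficient would be zero. *)
Lemma counting_euler_defect :
  n%:Z
  + \sum_(p \in [set p : nat | (3 <= p)%N]) (2 - p%:Z) * (t_p A p)%:Z
  + \sum_(q \in [set q : nat | (3 <= q)%N])
      (q%:Z - 2) * \sum_(p \in [set p : nat | (3 <= p)%N]) (t_pq A p q)%:Z
  = euler_defect A.
Proof.
have card1 F : F \in flats A 1 -> (3 <= #|F|)%N.
  move=> /flatsP[_ dF]; have := dim_flat_ge A F; rewrite dF dim_rV4; lia.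
have card2 F : F \in flats A 2 -> (2 <= #|F|)%N.
  move=> /flatsP[_ dF]; have := dim_flat_ge A F; rewrite dF dim_rV4; lia.
have inc1 FL : FL \in incidences -> (3 <= #|FL.1|)%N.
  by rewrite inE => /and3P[/card1].
have inc2 FL : FL \in incidences -> (2 <= #|FL.2|)%N.
  by rewrite inE => /and3P[_ /card2].
rewrite /euler_defect card_ord; congr (_ + _ + _).
  under eq_fsbigr do rewrite t_pE.
  rewrite (@fsbig_card _ (flats A 1) (fun F => #|F|) (fun p => 2 - p%:Z)) //.
  by move=> F /card1; lia.
(* For fixed [q], the inner sum has constant coefficient 1 and counts the incidences whose line has
   multiplicity [q]. *)
under eq_fsbigr => q _.
  under eq_fsbigr do rewrite t_pqE -[X in X%:Z]mul1n PoszM.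
  rewrite (@fsbig_card _ [set FL in incidences | #|FL.2| == q]%SET (fun FL => #|FL.1|) (fun=> 1));
    last by move=> FL; rewrite inE => /andP[/inc1 h _]; rewrite ltnNge h.
  rewrite sumr_const [X in _ * X]natz; over.
rewrite (@fsbig_card _ incidences (fun FL => #|FL.2|) (fun q => q%:Z - 2)); last first.
  by move=> FL /inc2; lia.
rewrite pair_big_dep /=; apply: eq_bigl => FL.
by rewrite inE.
Qed.

End Counting.

Theorem theorem3p7 (R : realType) (n : nat) (A : arrangement R n)
  (hA : essential A) :
  simplicial A <->
  n%:Z
  + \sum_(p \in [set p : nat | (3 <= p)%N]) (2 - p%:Z) * (t_p A p)%:Z
  + \sum_(q \in [set q : nat | (3 <= q)%N])
      (q%:Z - 2) * \sum_(p \in [set p : nat | (3 <= p)%N]) (t_pq A p q)%:Z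
  = 0 :> int.
Proof.
by rewrite counting_euler_defect; apply/simplicial_defect/span_forms_flat.
Qed.
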